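(* Let the index set be $\Phi=\{\omega_0,\omega_1,\omega_2,\alpha_1,\alpha_2,\alpha_3,\beta_1,\dots,\beta_4,\gamma_1,\dots,\gamma_4,\delta_1,\dots,\delta_4,\epsilon_1,\dots,\epsilon_4\}$ (22 elements, in this order). Suppose that: (a) $S'=S^{(13)}_{14}\oplus S^{(5)}_8\oplus(1)\oplus(1)\oplus(1)$ and $T'=T^{(13)}_{14}\oplus T^{(5)}_8\oplus(1)\oplus(1)\oplus(1)$ are the explicit $22\times22$ block diagonal matrices whose blocks are given in the context; (b) $T$ is the $22\times 22$ diagonal matrix $T=\mathrm{diag}(e^{2\pi i t_x})_{x\in\Phi}$ with $$(t_x)_{x\in\Phi}=\left(0,0,0,0,0,0,\tfrac15,\tfrac25,\tfrac35,\tfrac45,\tfrac9{13},\tfrac6{13},\tfrac4{13},\tfrac7{13},\tfrac3{13},\tfrac2{13},\tfrac{10}{13},\tfrac{11}{13},\tfrac1{13},\tfrac5{13},\tfrac{12}{13},\tfrac8{13}\right);$$ (c) $S=(S_{xy})_{x,y\in\Phi}$ is a $22\times22$ complex matrix whose first three rows and columns are given by $S_{\omega_i,x}=S_{x,\omega_i}=\sigma^i(S_{\omega_0,x})$ for $0\le i\le 2$, $x\in\Phi$, where the numbers $S_{\omega_0,x}$ and the field automorphism $\sigma$ are given in the context; (d) the two column vectors $(1,1,1,1,1,1,0,\dots,0)^{\mathsf T}$ and $(1,1,1,2,1,0,0,\dots,0)^{\mathsf T}$ of length 22 are eigenvectors of both $S$ and $T$ with eigenvalue $1$; (e) $S$ is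 symmetric; (f) $\sum_{y\in\Phi}S_{xy}S_{xy}=1$ for every $x\in\{\gamma_i,\delta_i,\epsilon_i: 1\le i\le 4\}$; (g) $Q$ is an invertible $22\times 22$ complex matrix with $QS=S'Q$ and $QT=T'Q$. Then $S$ is the following symmetric matrix. In block form with respect to the decomposition of $\Phi$ into $\{\omega_i\}$, $\{\alpha_i\}$, $\{\beta_j\}$, $\{\gamma_j\}\cup\{\delta_j\}\cup\{\epsilon_j\}$ (of sizes $3,3,4,12$), $$S=\begin{pmatrix}U&\frac15\mathbf 1&\frac15\mathbf 1&V\\ \frac15\mathbf 1& I-\frac15\mathbf 1&-\frac15\mathbf 1&0\\ \frac15\mathbf 1&-\frac15\mathbf 1&W&0\\ V^{\mathsf T}&0&0&M\end{pmatrix},\qquad M=\begin{pmatrix}A&B&C\\ B&-C&A\\ C&A&-B\end{pmatrix},$$ where $\mathbf 1$ denotes an all-ones block of the appropriate size, and, with $c_k=\cos(\pi k/65)$: $$U=\begin{pmatrix} u_1&u_2&u_3\\ u_2&u_3&u_1\\ u_3&u_1&u_2\end{pmatrix},$$ $u_1=\frac1{65}(7-10c_{20}-10c_{30})$, $u_2=\frac1{65}(7+10c_8+10c_{18}-10c_{21}+10c_{25}-10c_{31})$, $u_3=\frac1{65}(12-10c_8-10c_{18}+10c_{20}+10c_{21}-10c_{25}+10c_{30}+10c_{31})$; $V$ is the $3\times12$ matrix whose columns $\gamma_j$ are all $(v_1,v_2,v_3)^{\mathsf T}$, whose columns $\delta_j$ are all $(-v_2,-v_3,-v_1)^{\mathsf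 T}$, and whose columns $\epsilon_j$ are all $(-v_3,-v_1,-v_2)^{\mathsf T}$, with $v_1=\frac2{13}(c_8+c_{18}+c_{20}-c_{21}+c_{25}+c_{30}-c_{31})$, $v_2=\frac1{13}(1-4c_8-4c_{18}+2c_{20}+4c_{21}-4c_{25}+2c_{30}+4c_{31})$, $v_3=\frac1{13}(-1+2c_8+2c_{18}-4c_{20}-2c_{21}+2c_{25}-4c_{30}-2c_{31})$; $$W=\frac1{10}\begin{pmatrix}3-\sqrt5&-2-2\sqrt5&-2+2\sqrt5&3+\sqrt5\\-2-2\sqrt5&3+\sqrt5&3-\sqrt5&-2+2\sqrt5\\-2+2\sqrt5&3-\sqrt5&3+\sqrt5&-2-2\sqrt5\\3+\sqrt5&-2+2\sqrt5&-2-2\sqrt5&3-\sqrt5\end{pmatrix};$$ and $A,B,C$ are the $4\times4$ matrices $A_{ij}=a_{i+j-1}$, $B_{ij}=b_{i+j-1}$, $C_{ij}=d_{i+j-1}$, with subscripts read modulo 4 in $\{1,2,3,4\}$, where $a_1=\frac1{13}(2c_8-2c_{10}+2c_{18}-2c_{20}-2c_{21}+4c_{25}-4c_{30}-2c_{31}+1)$, $a_2=\frac1{13}(-2c_8+2c_{10}-2c_{18}+6c_{20}+2c_{21}-2c_{25}+2c_{31}+1)$, $a_3=\frac1{13}(2c_8+2c_{10}+2c_{18}-2c_{20}-2c_{21}-2c_{31}+2)$, $a_4=\frac1{13}(-2c_{10}-2c_{20}+4c_{30})$, $b_1=\frac1{13}(2c_{10}-2c_{20}-2c_{25}-2)$,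 $b_2=\frac1{13}(4c_8+4c_{18}+2c_{20}-4c_{21}-2c_{25}-4c_{31})$, $b_3=\frac1{13}(-2c_{10}-2c_{20}+2c_{25}-4c_{30}-3)$, $b_4=\frac1{13}(-2c_8-2c_{18}+2c_{21}+4c_{25}+2c_{30}+2c_{31})$, $d_1=\frac1{13}(2c_8+2c_{10}+2c_{18}-2c_{21}+2c_{30}-2c_{31}-2)$, $d_2=\frac1{13}(-6c_8+6c_{10}-6c_{18}+4c_{20}+6c_{21}-4c_{25}+4c_{30}+6c_{31}+2)$, $d_3=\frac1{13}(2c_8-2c_{10}+2c_{18}-2c_{21}+4c_{25}-2c_{30}-2c_{31}-3)$, $d_4=\frac1{13}(2c_8-6c_{10}+2c_{18}-2c_{20}-2c_{21}-2c_{30}-2c_{31}-1)$.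
   Context: **Notation.** $\xi_m=e^{2\pi i/m}$. **The first row of $S$ and the automorphism $\sigma$.** Let $\zeta=2\cos(2\pi/13)+2\cos(10\pi/13)$ and $\zeta'=2\cos(4\pi/13)+2\cos(6\pi/13)$; the field $\mathbb Q(\zeta)$ has degree 3 over $\mathbb Q$ with basis $1,\zeta,\zeta'$. Let $\sigma$ be its automorphism induced by $\xi_{13}\mapsto\xi_{13}^3$, so $\sigma(\zeta)=\zeta'$ and $\sigma(\zeta')=-1-\zeta-\zeta'$. The first row is $$S_{\omega_0,\omega_0}=\tfrac{7-5\zeta'}{65},\quad S_{\omega_0,\omega_1}=\tfrac{12+5\zeta+5\zeta'}{65},\quad S_{\omega_0,\omega_2}=\tfrac{7-5\zeta}{65},\quad S_{\omega_0,\alpha_i}=S_{\omega_0,\beta_j}=\tfrac15,$$ $$S_{\omega_0,\gamma_j}=\tfrac{1+\zeta+2\zeta'}{13},\quad S_{\omega_0,\delta_j}=\tfrac{1+2\zeta+\zeta'}{13},\quad S_{\omega_0,\epsilon_j}=\tfrac{-\zeta+\zeta'}{13}.$$ **The matrices $S^{(5)}_8,T^{(5)}_8$.** $T_8^{(5)}=\mathrm{diag}(1,\xi_5,\xi_5^2,\xi_5^3,\xi_5^4)$ and, with $c=2\cos(2\pi/5)$, $c'=2\cos(4\pi/5)$, $$S^{(5)}_8=\frac15\begin{pmatrix}-1&-6&-6&-6&-6\\-1&-2c-c'&2c'&2c&-c-2c'\\-1&2c'&-c-2c'&-2c-c'&2c\\-1&2c&-2c-c'&-c-2c'&2c'\\-1&-c-2c'&2c&2c'&-2c-c'\end{pmatrix}.$$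 **The matrices $S^{(13)}_{14},T^{(13)}_{14}$.** These are $14\times14$, with rows and columns labelled $0,1,2,\dots,12,0'$ in that order. $T^{(13)}_{14}$ is diagonal with entries $1$ at $0$ and $0'$, and $\xi_{13}^l$ at $l$ for $1\le l\le 12$. Write $\kappa_j=2\cos(2\pi j/13)$, $\varepsilon=(1,1,-1,-1,1,-1)$, $\varepsilon'=(1,1,1,-1,1,1)$, and $s(l)=(\kappa_l-\kappa_{2l}-\kappa_{3l}+\kappa_{5l})/13$, $s'(l)=(1+3\kappa_l+3\kappa_{5l})/13$, $t(l)=(2-\kappa_l+\kappa_{2l}-\kappa_{4l})/13$, $t'(l)=(2\kappa_{2l}-\kappa_{3l}-\kappa_{5l})/13$. The entries of $S^{(13)}_{14}$ (written $S_{ab}$ in this paragraph only) are, for $l,m\in\{1,\dots,6\}$ and with subscripts $l^2,2l^2,m^2,2m^2$ taken mod 13: $$S_{00}=s(1),\quad S_{00'}=s(2),\quad S_{0'0}=-s(4),\quad S_{0'0'}=-s(1),$$ $$S_{l^2,0}=\varepsilon_l s(l),\quad S_{0,l^2}=\varepsilon_l s'(l),\quad S_{2l^2,0}=\varepsilon'_l s(4l),\quad S_{0,2l^2}=\varepsilon'_l s'(4l),$$ $$S_{l^2,0'}=\varepsilon_l s(2l),\quad S_{0',l^2}=-\varepsilon_l s'(4l),\quad S_{2l^2,0'}=\varepsilon'_l s(5l),\quad S_{0',2l^2}=-\varepsilon'_l s'(3l),$$ $$S_{l^2,m^2}=\varepsilon_l\varepsilon_m t(lm),\quad S_{l^2,2m^2}=S_{2m^2,l^2}=\varepsilon_l\varepsilon'_m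 t'(lm),\quad S_{2l^2,2m^2}=\varepsilon'_l\varepsilon'_m t(2lm).$$ *)

(* Defs.v *)
From HB Require Import structures.
From mathcomp Require Import all_boot all_order all_algebra.
From mathcomp Require Import complex.
From mathcomp Require Import all_classical all_reals all_analysis.

Set Implicit Arguments.
Unset Strict Implicit.
Unset Printing Implicit Defensive.

Import Order.TTheory GRing.Theory Num.Theory.

Local Open Scope ring_scope.
Local Open Scope complex_scope.

Section Generalities.
Variable R : realType.
Local Notation C := R[i].

(* exp (i x) *)
Definition expi (x : R) : C := cos x +i* sin x.

(* xi m = exp (2 pi i / m) *)
Definition xi (m : nat) : C := expi (2 * pi / m%:R).

Definition mx_of_rows (T : nzRingType) (m n : nat) (rows : seq (seq T)) :
    'M[T]_(m, n) :=
  \matrix_(i < m, j < n) nth 0 (nth [::] rows i) j.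

Definition direct_sum_mx (T : nzRingType) (m n : nat)
    (A : 'M[T]_m) (B : 'M[T]_n) : 'M[T]_(m + n) :=
  block_mx A 0 0 B.

(* MathComp's [eigenvalue] and [eigenspace] are about row vectors. *)
Definition col_eigenvector (F : fieldType) (n : nat) (A : 'M[F]_n) (a : F)
    (v : 'cV[F]_n) : Prop :=
  v != 0 /\ A *m v = a *: v.

(* Q(z): the intersection of all subfields of C that contain z. *)
Definition Qadjoin (z : C) : set C :=
  [set x : C | forall F : {pred C}, divring_closed F -> z \in F -> x \in F].

(* The map s is only relevant on K; its values elsewhere are junk. *)
Definition field_automorphism (K : set C) (s : C -> C) : Prop :=
  [/\ set_bij K K s, s 1 = 1,
      {in K &, {morph s : x y / x + y}} &
      {in K &, {morph s : x y / x * y}}].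

End Generalities.

Section FirstRow.
Variable R : realType.
Local Notation C := R[i].

Definition zeta : C :=
  (2 * cos (2 * pi / 13) + 2 * cos (10 * pi / 13) : R)%:C.
Definition zeta' : C :=
  (2 * cos (4 * pi / 13) + 2 * cos (6 * pi / 13) : R)%:C.

(* sigma is the automorphism of Q(zeta) induced by xi_13 |-> xi_13 ^ 3, that
   is, the restriction of the automorphism tau of Q(xi_13) with
   tau xi_13 = xi_13 ^ 3. *)
Definition is_sigma (sigma : C -> C) : Prop :=
  field_automorphism (Qadjoin zeta) sigma /\
  exists tau : C -> C,
    [/\ field_automorphism (Qadjoin (xi R 13)) tau,
        tau (xi R 13) = xi R 13 ^+ 3 &
        {in Qadjoin zeta, sigma =1 tau}].

Definition S_row0 : seq C :=
  [:: (7 - 5 * zeta') / 65;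
      (12 + 5 * zeta + 5 * zeta') / 65;
      (7 - 5 * zeta) / 65]
  ++ nseq 7 (1 / 5)
  ++ nseq 4 ((1 + zeta + 2 * zeta') / 13)
  ++ nseq 4 ((1 + 2 * zeta + zeta') / 13)
  ++ nseq 4 ((- zeta + zeta') / 13).

End FirstRow.

(* The index set Phi is 'I_22; indices inside each family start at 0, so that
   [alpha ord0] is alpha_1, while [omega ord0] is omega_0. *)
Definition omega (i : 'I_3) : 'I_22 := @lshift 3 19 i.
Definition alpha (i : 'I_3) : 'I_22 := @rshift 3 19 (@lshift 3 16 i).
Definition beta (j : 'I_4) : 'I_22 := @rshift 6 16 (@lshift 4 12 j).
Definition gamma (j : 'I_4) : 'I_22 := @rshift 10 12 (@lshift 4 8 j).
Definition delta (j : 'I_4) : 'I_22 := @rshift 14 8 (@lshift 4 4 j).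
Definition epsilon (j : 'I_4) : 'I_22 := @rshift 18 4 j.

Section Level5.
Variable R : realType.
Local Notation C := R[i].

Definition T5 : 'M[C]_5 := diag_mx (\row_(l < 5) xi R 5 ^+ l).

Definition S5 : 'M[R]_5 :=
  let c : R := 2 * cos (2 * pi / 5) in
  let c' : R := 2 * cos (4 * pi / 5) in
  5^-1 *: mx_of_rows 5 5
    [:: [:: -1;            - 6;            - 6;            - 6;            - 6];
        [:: -1; - 2 * c - c';       2 * c';        2 * c;   - c - 2 * c'];
        [:: -1;       2 * c'; - c - 2 * c'; - 2 * c - c';        2 * c];
        [:: -1;        2 * c; - 2 * c - c'; - c - 2 * c';       2 * c'];
        [:: -1; - c - 2 * c';        2 * c;       2 * c'; - 2 * c - c']].

End Level5.

(* The labels 0, 1, ..., 12, 0' of the rows and columns of S14: a nonzero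
   residue mod 13 is l ^ 2 or 2 l ^ 2 for a unique l in {1, ..., 6}. *)
Inductive label13 : Type :=
| Lzero
| Lzero'
| Lsqr of nat
| Ltwosqr of nat.

Definition labels13 : seq label13 :=
  [:: Lzero; Lsqr 1; Ltwosqr 1; Lsqr 4; Lsqr 2; Ltwosqr 3; Ltwosqr 4;
      Ltwosqr 6; Ltwosqr 2; Lsqr 3; Lsqr 6; Ltwosqr 5; Lsqr 5; Lzero'].

Fact labels13_sqr (l : nat) : (0 < l <= 6)%N ->
  nth Lzero labels13 (l ^ 2 %% 13) = Lsqr l.
Proof. by move: l; do 7?[case=> //]. Qed.

Fact labels13_twosqr (l : nat) : (0 < l <= 6)%N ->
  nth Lzero labels13 (2 * l ^ 2 %% 13) = Ltwosqr l.
Proof. by move: l; do 7?[case=> //]. Qed.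

Section Level13.
Variable R : realType.
Local Notation C := R[i].

Definition kappa (j : nat) : R := 2 * cos (2 * pi * j%:R / 13).

Definition sgn13 (l : nat) : R := [:: 1; 1; -1; -1; 1; -1]`_l.-1.
Definition sgn13' (l : nat) : R := [:: 1; 1; 1; -1; 1; 1]`_l.-1.

Definition s13 (l : nat) : R :=
  (kappa l - kappa (2 * l) - kappa (3 * l) + kappa (5 * l)) / 13.
Definition s13' (l : nat) : R :=
  (1 + 3 * kappa l + 3 * kappa (5 * l)) / 13.
Definition t13 (l : nat) : R :=
  (2 - kappa l + kappa (2 * l) - kappa (4 * l)) / 13.
Definition t13' (l : nat) : R :=
  (2 * kappa (2 * l) - kappa (3 * l) - kappa (5 * l)) / 13.

Definition S14_entry (a b : label13) : R :=
  match a, b with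
  | Lzero, Lzero => s13 1
  | Lzero, Lzero' => s13 2
  | Lzero', Lzero => - s13 4
  | Lzero', Lzero' => - s13 1
  | Lsqr l, Lzero => sgn13 l * s13 l
  | Lzero, Lsqr l => sgn13 l * s13' l
  | Ltwosqr l, Lzero => sgn13' l * s13 (4 * l)
  | Lzero, Ltwosqr l => sgn13' l * s13' (4 * l)
  | Lsqr l, Lzero' => sgn13 l * s13 (2 * l)
  | Lzero', Lsqr l => - sgn13 l * s13' (4 * l)
  | Ltwosqr l, Lzero' => sgn13' l * s13 (5 * l)
  | Lzero', Ltwosqr l => - sgn13' l * s13' (3 * l)
  | Lsqr l, Lsqr m => sgn13 l * sgn13 m * t13 (l * m)
  | Lsqr l, Ltwosqr m => sgn13 l * sgn13' m * t13' (l * m)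
  | Ltwosqr m, Lsqr l => sgn13 l * sgn13' m * t13' (l * m)
  | Ltwosqr l, Ltwosqr m => sgn13' l * sgn13' m * t13 (2 * l * m)
  end.

Definition S14 : 'M[R]_14 :=
  \matrix_(i < 14, j < 14)
    S14_entry (nth Lzero labels13 i) (nth Lzero labels13 j).

Definition T14 : 'M[C]_14 :=
  diag_mx (\row_(l < 14) if l == 13%N :> nat then 1 else xi R 13 ^+ l).

End Level13.

Section BigMatrices.
Variable R : realType.
Local Notation C := R[i].

Definition Sprime : 'M[C]_22 :=
  map_mx (real_complex R)
    (direct_sum_mx (S14 R) (direct_sum_mx (S5 R) (1%:M : 'M[R]_3))).

Definition Tprime : 'M[C]_22 :=
  direct_sum_mx (T14 R) (direct_sum_mx (T5 R) (1%:M : 'M[C]_3)).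

Definition t_exponents : seq R :=
  [:: 0; 0; 0; 0; 0; 0;
      1/5; 2/5; 3/5; 4/5;
      9/13; 6/13; 4/13; 7/13;
      3/13; 2/13; 10/13; 11/13;
      1/13; 5/13; 12/13; 8/13].

Definition Tmx : 'M[C]_22 :=
  diag_mx (\row_(x < 22) expi (2 * pi * t_exponents`_x)).

Definition eigvec1 : 'cV[C]_22 := \col_(x < 22) [:: 1; 1; 1; 1; 1; 1]`_x.
Definition eigvec2 : 'cV[C]_22 := \col_(x < 22) [:: 1; 1; 1; 2; 1]`_x.

End BigMatrices.

Section FinalMatrix.
Variable R : realType.

Definition cos65 (k : nat) : R := cos (pi * k%:R / 65).
Local Notation c := cos65.

Definition Umx : 'M[R]_3 :=
  let u1 := 65^-1 * (7 - 10 * c 20 - 10 * c 30) in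
  let u2 := 65^-1 * (7 + 10 * c 8 + 10 * c 18 - 10 * c 21 + 10 * c 25
                     - 10 * c 31) in
  let u3 := 65^-1 * (12 - 10 * c 8 - 10 * c 18 + 10 * c 20 + 10 * c 21
                     - 10 * c 25 + 10 * c 30 + 10 * c 31) in
  mx_of_rows 3 3 [:: [:: u1; u2; u3]; [:: u2; u3; u1]; [:: u3; u1; u2]].

Definition Vmx : 'M[R]_(3, 12) :=
  let v1 := 2 / 13 * (c 8 + c 18 + c 20 - c 21 + c 25 + c 30 - c 31) in
  let v2 := 13^-1 * (1 - 4 * c 8 - 4 * c 18 + 2 * c 20 + 4 * c 21 - 4 * c 25
                     + 2 * c 30 + 4 * c 31) in
  let v3 := 13^-1 * (-1 + 2 * c 8 + 2 * c 18 - 4 * c 20 - 2 * c 21 + 2 * c 25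
                     - 4 * c 30 - 2 * c 31) in
  row_mx (\matrix_(i < 3, j < 4) [:: v1; v2; v3]`_i)
    (row_mx (\matrix_(i < 3, j < 4) [:: - v2; - v3; - v1]`_i)
            (\matrix_(i < 3, j < 4) [:: - v3; - v1; - v2]`_i)).

Definition Wmx : 'M[R]_4 :=
  let r : R := Num.sqrt 5 in
  10^-1 *: mx_of_rows 4 4
    [:: [::       3 - r; - 2 - 2 * r; - 2 + 2 * r;       3 + r];
        [:: - 2 - 2 * r;       3 + r;       3 - r; - 2 + 2 * r];
        [:: - 2 + 2 * r;       3 - r;       3 + r; - 2 - 2 * r];
        [::       3 + r; - 2 + 2 * r; - 2 - 2 * r;       3 - r]].

(* The entry at the 1-based position (i, j) is the term of 1-based rank
   i + j - 1 mod 4, that is, 0-based i + j mod 4. *)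
Definition anticirculant_mx (a : seq R) : 'M[R]_4 :=
  \matrix_(i < 4, j < 4) a`_((i + j) %% 4).

Definition Amx : 'M[R]_4 := anticirculant_mx
  [:: 13^-1 * (2 * c 8 - 2 * c 10 + 2 * c 18 - 2 * c 20 - 2 * c 21 + 4 * c 25
               - 4 * c 30 - 2 * c 31 + 1);
      13^-1 * (- 2 * c 8 + 2 * c 10 - 2 * c 18 + 6 * c 20 + 2 * c 21 - 2 * c 25
               + 2 * c 31 + 1);
      13^-1 * (2 * c 8 + 2 * c 10 + 2 * c 18 - 2 * c 20 - 2 * c 21 - 2 * c 31
               + 2);
      13^-1 * (- 2 * c 10 - 2 * c 20 + 4 * c 30)].

Definition Bmx : 'M[R]_4 := anticirculant_mx
  [:: 13^-1 * (2 * c 10 - 2 * c 20 - 2 * c 25 - 2);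
      13^-1 * (4 * c 8 + 4 * c 18 + 2 * c 20 - 4 * c 21 - 2 * c 25 - 4 * c 31);
      13^-1 * (- 2 * c 10 - 2 * c 20 + 2 * c 25 - 4 * c 30 - 3);
      13^-1 * (- 2 * c 8 - 2 * c 18 + 2 * c 21 + 4 * c 25 + 2 * c 30
               + 2 * c 31)].

Definition Cmx : 'M[R]_4 := anticirculant_mx
  [:: 13^-1 * (2 * c 8 + 2 * c 10 + 2 * c 18 - 2 * c 21 + 2 * c 30 - 2 * c 31
               - 2);
      13^-1 * (- 6 * c 8 + 6 * c 10 - 6 * c 18 + 4 * c 20 + 6 * c 21 - 4 * c 25
               + 4 * c 30 + 6 * c 31 + 2);
      13^-1 * (2 * c 8 - 2 * c 10 + 2 * c 18 - 2 * c 21 + 4 * c 25 - 2 * c 30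
               - 2 * c 31 - 3);
      13^-1 * (2 * c 8 - 6 * c 10 + 2 * c 18 - 2 * c 20 - 2 * c 21 - 2 * c 30
               - 2 * c 31 - 1)].

Definition Mmx : 'M[R]_12 :=
  col_mx (row_mx Amx (row_mx Bmx Cmx))
  (col_mx (row_mx Bmx (row_mx (- Cmx) Amx))
          (row_mx Cmx (row_mx Amx (- Bmx)))).

Local Notation fifth := (const_mx (1 / 5)).

Definition Sfinal : 'M[R]_22 :=
  (col_mx (row_mx Umx   (row_mx fifth           (row_mx fifth     Vmx)))
  (col_mx (row_mx fifth (row_mx (1%:M - fifth)  (row_mx (- fifth) 0)))
  (col_mx (row_mx fifth (row_mx (- fifth)       (row_mx Wmx       0)))
          (row_mx Vmx^T (row_mx 0               (row_mx 0         Mmx)))))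
   : 'M[R]_(3 + (3 + (4 + 12)), 3 + (3 + (4 + 12)))).

End FinalMatrix.

(* Main.v *)
(* The eigenvalues of T and T' other than 1 are simple and match up, so Q has a
   single nonzero entry q_x in the row and column that belong to each x in
   beta, gamma, delta or epsilon, and q_x S_xy = S'_xy q_y on these labels.
   - On beta, comparing with the column 0 of the level 5 block shows that q_x
     is constant, so that S and S' agree there.
   - On the last twelve labels, set r_x = e_x q_x for suitable signs e_x. The
     known rows of S say that (S_{x omega_0}, S_{x omega_1}) is an eigenvector
     of eigenvalue r_x of a 2 x 2 matrix independent of x. Three pairwise
     independent such vectors add up to zero, so all r_x are equal.
   - The two eigenvectors of S leave one free parameter in each of the blocks
     alpha x beta, alpha x (last twelve) and alpha x alpha. They are found from
     QS = S'Q, from the norm condition and from tr S = tr S' respectively. *)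
Require Import Defs.
From mathcomp Require Import all_boot all_order all_algebra.
From mathcomp Require Import complex.
From mathcomp Require Import all_classical all_reals all_analysis.
From mathcomp Require Import zify ring lra.

Set Implicit Arguments.
Unset Strict Implicit.
Unset Printing Implicit Defensive.

Import Order.TTheory GRing.Theory Num.Theory.

Local Open Scope ring_scope.
Local Open Scope complex_scope.

(** * The exponential [expi] and the roots of unity [xi] *)

Section Exponential.
Variable R : realType.
Implicit Types x y : R.

Lemma expi0 : expi 0 = 1 :> R[i].
Proof. by rewrite /expi cos0 sin0. Qed.

Lemma expiD x y : expi (x + y) = expi x * expi y.
Proof.
rewrite /expi cosD sinD; apply/eqP; rewrite eq_complex /= eqxx /=.
by apply/eqP; ring.
Qed.

Lemma expi_natmul x n : expi (x * n%:R) = expi x ^+ n.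
Proof.
elim: n => [|n IHn]; first by rewrite mulr0 expi0.
by rewrite exprS -IHn -natr1 mulrDr mulr1 addrC expiD.
Qed.

Lemma expi2pi : expi (2 * pi) = 1 :> R[i].
Proof. by rewrite mulr_natl /expi cos2pi sin2pi. Qed.

Lemma expi_neq0 x : expi x != 0.
Proof.
apply/negP => /eqP h; have := oner_neq0 R[i].
by rewrite -expi0 -(subrr x) expiD h mul0r eqxx.
Qed.

(** Equality would give 1 = cos x = 1 - 2 sin (x / 2) ^ 2, while sin (x / 2) is positive on this
    range. *)
Lemma expi_neq1 x : 0 < x < 2 * pi -> expi x != 1.
Proof.
move=> /andP[x_gt0 x_lt]; have s0 : 0 < sin (x / 2) by rewrite sin_gt0_pi; lra.
apply/negP => /eqP[+ _].
rewrite [x in cos x](_ : x = (x / 2) *+ 2); last by rewrite -mulr_natr divfK.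
rewrite cos_mulr2n cos2sin2 => h.
have := exprn_gt0 2 s0; lra.
Qed.

Lemma xi_pow m n : (0 < m)%N -> xi R m ^+ n = expi (2 * pi * n%:R / m%:R).
Proof. by move=> _; rewrite /xi -expi_natmul mulrAC. Qed.

Lemma xi_order m : (0 < m)%N -> xi R m ^+ m = 1.
Proof.
by move=> m0; rewrite xi_pow // mulfK ?pnatr_eq0 -?lt0n // expi2pi.
Qed.

(** The quotient of the two powers is [expi] of an angle strictly between 0 and 2 pi unless a =
    b. *)
Lemma xi_pow_inj m a b : (a < m)%N -> (b < m)%N ->
  xi R m ^+ a = xi R m ^+ b -> a = b.
Proof.
wlog le_ab : a b / (a <= b)%N => [wl am bm e|am bm].
  by case: (leqP a b) => [/wl|/ltnW /wl h]; [apply|rewrite h].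
have m0 : (0 < m)%N by apply: leq_ltn_trans am.
have xi0 : xi R m != 0 by apply: expi_neq0.
rewrite -[in X in _ = X -> _](subnKC le_ab) exprD -[X in X = _ -> _]mulr1.
move=> /(mulfI (expf_neq0 a xi0)).
move=> /esym/eqP; apply: contraTeq => ne_ab.
have d0 : (0 < b - a)%N by rewrite subn_gt0 ltn_neqAle ne_ab.
rewrite xi_pow //; apply: expi_neq1.
have p0 := pi_gt0 R; have m0' : 0 < m%:R :> R by rewrite ltr0n.
rewrite divr_gt0 ?mulr_gt0 ?ltr0n //= ltr_pdivrMr // ltr_pM2l ?mulr_gt0 //.
by rewrite ltr_nat (leq_ltn_trans (leq_subr _ _)).
Qed.

(** This is the real part of [expi x] times a geometric sum, which vanishes since its product with
    [xi R m - 1] is [xi R m ^+ m - 1 = 0]. *)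
Lemma sum_cos_rotations m x : (1 < m)%N ->
  \sum_(j < m) cos (x + 2 * pi * j%:R / m%:R) = 0.
Proof.
move=> m1; have m0 := ltnW m1.
have h : \sum_(j < m) expi (x + 2 * pi * j%:R / m%:R) = 0.
  under eq_bigr do rewrite expiD -xi_pow //.
  rewrite -mulr_sumr [X in _ * X](_ : _ = 0) ?mulr0 //.
  have xi1 : xi R m - 1 != 0.
    rewrite subr_eq0; apply: contra_neq (oner_neq0 nat) => h1.
    by apply: (@xi_pow_inj m) => //; rewrite expr0.
  by apply: (mulfI xi1); rewrite -subrX1 xi_order // subrr mulr0.
have := congr1 (@complex.Re R) h; rewrite raddf_sum /=.
by apply: etrans; apply: eq_bigr.
Qed.

Lemma cosMcos x y : 2 * cos x * (2 * cos y) = 2 * cos (x + y) + 2 * cos (x - y).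
Proof. by rewrite cosD cosB; ring. Qed.

End Exponential.

(** * Relations between the numbers 2 cos (2 pi j / 13) *)

Section Kappa.
Variable R : realType.
Local Notation kappa := (kappa R).

Lemma cosD_2pi_natmul (x : R) n : cos (x + 2 * pi * n%:R) = cos x.
Proof.
have := expiD x (2 * pi * n%:R); rewrite expi_natmul expi2pi expr1n mulr1.
by case.
Qed.

Lemma kappa0 : kappa 0 = 2.
Proof. by rewrite /Defs.kappa mulr0 mul0r cos0 mulr1. Qed.

Lemma kappa_mod n : kappa (n %% 13) = kappa n.
Proof.
rewrite /Defs.kappa [in RHS](divn_eq n 13) addnC natrD natrM.
rewrite [X in _ = _ * cos X](_ : _ = 2 * pi * (n %% 13)%:R / 13
  + 2 * pi * (n %/ 13)%:R).
  by rewrite cosD_2pi_natmul.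
by field.
Qed.

Lemma kappaB n : (n <= 13)%N -> kappa (13 - n) = kappa n.
Proof.
move=> le_n; rewrite /Defs.kappa -[in RHS]cosN.
rewrite -[X in _ = 2 * X](cosD_2pi_natmul _ 1) natrB //.
by congr (2 * cos _); field.
Qed.

(* 12 n stands for - n modulo 13. *)
Lemma kappaM m n : kappa m * kappa n = kappa (m + n) + kappa (m + 12 * n).
Proof.
rewrite cosMcos -[X in _ + 2 * X](cosD_2pi_natmul _ n) /Defs.kappa natrD.
by congr (2 * cos _ + 2 * cos _); rewrite ?natrD ?natrM; field.
Qed.

Lemma sum_kappa : \sum_(1 <= j < 7) kappa j = -1.
Proof.
have := @sum_cos_rotations R 13 0 isT.
rewrite !big_ord_recr big_ord0 /= => h.
have E j : cos (0 + 2 * pi * j%:R / 13%:R) = kappa j / 2.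
  by rewrite /Defs.kappa add0r [2 * cos _]mulrC mulfK.
move: h; rewrite !E kappa0 -[kappa 7]kappaB // -[kappa 8]kappaB //.
rewrite -[kappa 9]kappaB // -[kappa 10]kappaB // -[kappa 11]kappaB //.
rewrite -[kappa 12]kappaB //= !subSS subn0.
by rewrite unlock /= => h; lra.
Qed.

End Kappa.

(** * Deciding identities between the [kappa n] by integer computation *)

Section KappaTerms.
Variable R : realType.
Local Notation kappa := (kappa R).

(* [(c, n)] stands for [c * kappa n]; as [kappa 0 = 2], integral constants are
   represented after doubling. *)
Definition kterms := seq (int * nat).

Definition keval (l : kterms) : R := \sum_(p <- l) p.1%:~R * kappa p.2.

Definition kscale (c : int) (l : kterms) : kterms :=
  [seq (c * p.1, p.2) | p <- l].

(** Each pair of terms is multiplied by [kappaM]; the indices stay unreduced, as [kcoord] reduces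
    them modulo 13. *)
Definition kmul (l1 l2 : kterms) : kterms :=
  flatten [seq flatten [seq [:: (p.1 * q.1, (p.2 + q.2)%N);
                               (p.1 * q.1, (p.2 + 12 * q.2)%N)]
                       | q <- l2] | p <- l1].

(* Coordinates of [kappa n] in the basis [kappa 1, ..., kappa 6]. *)
Definition kcoord (n j : nat) : int :=
  let r := (n %% 13)%N in
  let r := if (r <= 6)%N then r else (13 - r)%N in
  if r == 0%N then -2 else (r == j)%:Z.

Definition kcoef (l : kterms) (j : nat) : int :=
  foldr (fun p s => p.1 * kcoord p.2 j + s) 0 l.

Definition keq (l1 l2 : kterms) : bool :=
  all (fun j => kcoef l1 j == kcoef l2 j) (iota 1 6).

(** Reduce n modulo 13, fold a residue r > 6 to 13 - r, and replace [kappa 0 = 2] by -2 times the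
    sum of [kappa 1], ..., [kappa 6], which is -1. *)
Lemma kappa_coord n : kappa n = \sum_(1 <= j < 7) (kcoord n j)%:~R * kappa j.
Proof.
rewrite -kappa_mod /kcoord; have := ltn_pmod n (isT : (0 < 13)%N).
set r := (n %% 13)%N => r_lt.
set q := if _ then _ else _.
have -> : kappa r = kappa q.
  by rewrite /q; case: ifP => // _; rewrite kappaB // ltnW.
have q6 : (q <= 6)%N by rewrite /q; case: ifP => // /negbT; lia.
move: q q6 => {r r_lt} q q6; case: (eqVneq q 0%N) => [->|q0].
  by rewrite -mulr_sumr sum_kappa kappa0; lra.
rewrite (bigD1_seq q) /= ?iota_uniq ?mem_index_iota ?q0 ?lt0n ?q0 ?ltnS //.
rewrite eqxx mul1r big1 ?addr0 // => j /negPf; rewrite eq_sym => ->.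
by rewrite mul0r.
Qed.

Lemma keval_coef l : keval l = \sum_(1 <= j < 7) (kcoef l j)%:~R * kappa j.
Proof.
rewrite /keval; elim: l => [|p l IHl].
  by rewrite big_nil big1 // => j _; rewrite mul0r.
rewrite big_cons IHl kappa_coord mulr_sumr -big_split /=.
by apply: eq_bigr => j _; rewrite intrD intrM mulrDl mulrA.
Qed.

(** Through this lemma the level 13 identities below become comparisons of integers, settled by
    [vm_compute]. *)
Lemma keval_eq l1 l2 : keq l1 l2 -> keval l1 = keval l2.
Proof.
move=> /allP h; rewrite !keval_coef !big_seq; apply: eq_bigr => j.
by rewrite mem_index_iota => hj; rewrite (eqP (h j _)) // mem_iota.
Qed.

Lemma keval_cons c n l : keval ((c, n) :: l) = c%:~R * kappa n + keval l.
Proof. by rewrite /keval big_cons. Qed.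

Lemma keval_nil : keval [::] = 0.
Proof. by rewrite /keval big_nil. Qed.

Lemma keval_cat l1 l2 : keval (l1 ++ l2) = keval l1 + keval l2.
Proof. by rewrite /keval big_cat. Qed.

Lemma keval_flatten T (f : T -> kterms) s :
  keval (flatten [seq f x | x <- s]) = \sum_(x <- s) keval (f x).
Proof.
elim: s => [|x s IHs]; first by rewrite big_nil keval_nil.
by rewrite /= keval_cat IHs big_cons.
Qed.

Lemma keval_scale c l : keval (kscale c l) = c%:~R * keval l.
Proof.
rewrite /keval big_map mulr_sumr; apply: eq_bigr => p _.
by rewrite /= intrM mulrA.
Qed.

Lemma kevalM l1 l2 : keval (kmul l1 l2) = keval l1 * keval l2.
Proof.
rewrite keval_flatten [keval l1]/keval mulr_suml; apply: eq_bigr => p _.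
rewrite keval_flatten [keval l2]/keval mulr_sumr; apply: eq_bigr => q _.
by rewrite !keval_cons keval_nil addr0 intrM -mulrDr -kappaM; ring.
Qed.

End KappaTerms.

(** * Entries of the level 13 block as integral combinations of the [kappa n] *)

Section Level13Terms.
Variable R : realType.

Definition sgn13_int (l : nat) : int := nth 0 [:: 1; 1; -1; -1; 1; -1] l.-1.
Definition sgn13'_int (l : nat) : int := nth 0 [:: 1; 1; 1; -1; 1; 1] l.-1.

(** These lists encode 26 times the entries: 13 clears the denominators, and 2 turns the constants
    into multiples of [kappa 0]. *)
Definition s13_terms (l : nat) : kterms :=
  [:: (2, l); (-2, (2 * l)%N); (-2, (3 * l)%N); (2, (5 * l)%N)].
Definition s13'_terms (l : nat) : kterms :=
  [:: (1, 0%N); (6, l); (6, (5 * l)%N)].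
Definition t13_terms (l : nat) : kterms :=
  [:: (2, 0%N); (-2, l); (2, (2 * l)%N); (-2, (4 * l)%N)].
Definition t13'_terms (l : nat) : kterms :=
  [:: (4, (2 * l)%N); (-2, (3 * l)%N); (-2, (5 * l)%N)].

Definition S14_terms (a b : label13) : kterms :=
  let e := sgn13_int in let e' := sgn13'_int in
  match a, b with
  | Lzero, Lzero => s13_terms 1
  | Lzero, Lzero' => s13_terms 2
  | Lzero', Lzero => kscale (-1) (s13_terms 4)
  | Lzero', Lzero' => kscale (-1) (s13_terms 1)
  | Lsqr l, Lzero => kscale (e l) (s13_terms l)
  | Lzero, Lsqr l => kscale (e l) (s13'_terms l)
  | Ltwosqr l, Lzero => kscale (e' l) (s13_terms (4 * l))
  | Lzero, Ltwosqr l => kscale (e' l) (s13'_terms (4 * l))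
  | Lsqr l, Lzero' => kscale (e l) (s13_terms (2 * l))
  | Lzero', Lsqr l => kscale (- e l) (s13'_terms (4 * l))
  | Ltwosqr l, Lzero' => kscale (e' l) (s13_terms (5 * l))
  | Lzero', Ltwosqr l => kscale (- e' l) (s13'_terms (3 * l))
  | Lsqr l, Lsqr m => kscale (e l * e m) (t13_terms (l * m))
  | Lsqr l, Ltwosqr m => kscale (e l * e' m) (t13'_terms (l * m))
  | Ltwosqr m, Lsqr l => kscale (e l * e' m) (t13'_terms (l * m))
  | Ltwosqr l, Ltwosqr m => kscale (e' l * e' m) (t13_terms (2 * l * m))
  end.

Lemma sgn13E l : sgn13 R l = (sgn13_int l)%:~R.
Proof.
by rewrite /sgn13 /sgn13_int; case: l.-1 => [|[|[|[|[|[|[|n]]]]]]] //=; ring.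
Qed.

Lemma sgn13'E l : sgn13' R l = (sgn13'_int l)%:~R.
Proof.
by rewrite /sgn13' /sgn13'_int; case: l.-1 => [|[|[|[|[|[|[|n]]]]]]] //=; ring.
Qed.

Lemma S14_entryE a b : S14_entry R a b = keval R (S14_terms a b) / 26.
Proof.
have E1 l : s13 R l = keval R (s13_terms l) / 26.
  by rewrite !keval_cons keval_nil /s13; field.
have E2 l : s13' R l = keval R (s13'_terms l) / 26.
  by rewrite !keval_cons keval_nil kappa0 /s13'; field.
have E3 l : t13 R l = keval R (t13_terms l) / 26.
  by rewrite !keval_cons keval_nil kappa0 /t13; field.
have E4 l : t13' R l = keval R (t13'_terms l) / 26.
  by rewrite !keval_cons keval_nil /t13'; field.
case: a b => [||l|l] [||m|m]; rewrite /S14_entry /S14_terms;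
  rewrite ?keval_scale ?(E1, E2, E3, E4) ?(sgn13E, sgn13'E);
  rewrite ?intrM ?rmorphN ?rmorph1 //; ring.
Qed.

End Level13Terms.

(** * The block M in terms of the [kappa n] *)

Section FinalTerms.
Variable R : realType.
Local Notation c := (cos65 R).

Lemma kappa_half n : kappa R n / 2 = cos (2 * pi * n%:R / 13).
Proof. by rewrite /kappa [2 * _]mulrC mulfK. Qed.

Lemma cos65_10 : c 10 = kappa R 1 / 2.
Proof. by rewrite kappa_half /cos65; congr cos; field. Qed.

Lemma cos65_20 : c 20 = kappa R 2 / 2.
Proof. by rewrite kappa_half /cos65; congr cos; field. Qed.

Lemma cos65_30 : c 30 = kappa R 3 / 2.
Proof. by rewrite kappa_half /cos65; congr cos; field. Qed.

(** The angle 5 pi / 13 is the supplement of 8 pi / 13. *)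
Lemma cos65_25 : c 25 = - kappa R 4 / 2.
Proof.
rewrite mulNr kappa_half /cos65 -cosDpi -[in RHS]cosN.
by rewrite -[RHS](@cosD_2pi_natmul R _ 1); congr cos; field.
Qed.

(* These four cosines lie outside Q(cos (2 pi / 13)), but the final matrix only
   involves this combination of them. *)
Lemma cos65_kappa6 : c 8 + c 18 - c 21 - c 31 = - kappa R 6 / 2.
Proof.
(* The five angles are pi k / 65 with k = 8, 34, 60, 86, 112. The third is 12 pi / 13; supplements
   and reflections take 34, 86, 112 to 31, 21, 18. *)
have := @sum_cos_rotations R 5 (pi * 8 / 65) isT.
rewrite !big_ord_recr big_ord0 /= add0r.
have -> : cos (pi * 8 / 65 + 2 * pi * 0%:R / 5) = c 8.
  by rewrite /cos65; congr cos; field.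
have -> : cos (pi * 8 / 65 + 2 * pi * 1 / 5) = - c 31.
  rewrite -[RHS]cosDpi -cosN -[LHS](@cosD_2pi_natmul R _ 1).
  by congr cos; field.
have -> : cos (pi * 8 / 65 + 2 * pi * 2 / 5) = kappa R 6 / 2.
  by rewrite kappa_half; congr cos; field.
have -> : cos (pi * 8 / 65 + 2 * pi * 3 / 5) = - c 21.
  by rewrite -[RHS]cosDpi; congr cos; field.
have -> : cos (pi * 8 / 65 + 2 * pi * 4 / 5) = c 18.
  by rewrite -cosN -[LHS](@cosD_2pi_natmul R _ 1); congr cos; field.
lra.
Qed.

(** The minus signs at indices 6 and 4 come from [cos65_kappa6] and [cos65_25]; x is the common
    coefficient of the four cosines that only occur together. *)
Definition cos_terms (x c10 c20 c25 c30 k : int) : kterms :=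
  [:: (- x, 6%N); (c10, 1%N); (c20, 2%N); (- c25, 4%N); (c30, 3%N); (k, 0%N)].

Lemma cos_termsE x c10 c20 c25 c30 k :
  keval R (cos_terms x c10 c20 c25 c30 k) / 26 =
  13^-1 * (x%:~R * (c 8 + c 18 - c 21 - c 31) + c10%:~R * c 10 + c20%:~R * c 20
           + c25%:~R * c 25 + c30%:~R * c 30 + k%:~R).
Proof.
rewrite !keval_cons keval_nil kappa0 !rmorphN.
by rewrite cos65_10 cos65_20 cos65_30 cos65_25 cos65_kappa6; field.
Qed.

Definition A_terms : seq kterms :=
  [:: cos_terms 2 (-2) (-2) 4 (-4) 1; cos_terms (-2) 2 6 (-2) 0 1;
      cos_terms 2 2 (-2) 0 0 2; cos_terms 0 (-2) (-2) 0 4 0].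
Definition B_terms : seq kterms :=
  [:: cos_terms 0 2 (-2) (-2) 0 (-2); cos_terms 4 0 2 (-2) 0 0;
      cos_terms 0 (-2) (-2) 2 (-4) (-3); cos_terms (-2) 0 0 4 2 0].
Definition C_terms : seq kterms :=
  [:: cos_terms 2 2 0 0 2 (-2); cos_terms (-6) 6 4 (-4) 4 2;
      cos_terms 2 (-2) 0 4 (-2) (-3); cos_terms 2 (-6) (-2) 0 (-2) (-1)].

Lemma anticirculant_mxE (a : seq R) (l : seq kterms) (i j : 'I_4) :
  a = [seq keval R x / 26 | x <- l] -> size l = 4%N ->
  anticirculant_mx a i j = keval R (nth [::] l ((i + j) %% 4)) / 26.
Proof. by move=> -> sl; rewrite mxE (nth_map [::]) // sl ltn_mod. Qed.

Lemma AmxE i j : Amx R i j = keval R (nth [::] A_terms ((i + j) %% 4)) / 26.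
Proof.
apply: anticirculant_mxE => //; rewrite /A_terms /= !cos_termsE.
by do 4?[congr (_ :: _); first by ring].
Qed.

Lemma BmxE i j : Bmx R i j = keval R (nth [::] B_terms ((i + j) %% 4)) / 26.
Proof.
apply: anticirculant_mxE => //; rewrite /B_terms /= !cos_termsE.
by do 4?[congr (_ :: _); first by ring].
Qed.

Lemma CmxE i j : Cmx R i j = keval R (nth [::] C_terms ((i + j) %% 4)) / 26.
Proof.
apply: anticirculant_mxE => //; rewrite /C_terms /= !cos_termsE.
by do 4?[congr (_ :: _); first by ring].
Qed.

Definition M_terms (x y : nat) : kterms :=
  let p := nth (0, [::]) (nth [::]
    [:: [:: (1, A_terms);  (1, B_terms); (1, C_terms)];
        [:: (1, B_terms); (-1, C_terms); (1, A_terms)];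
        [:: (1, C_terms);  (1, A_terms); (-1, B_terms)]] (x %/ 4)) (y %/ 4) in
  kscale p.1 (nth [::] p.2 ((x %% 4 + y %% 4) %% 4)).

Lemma ord12_split (P : 'I_12 -> Type) :
  (forall i : 'I_4, P (@lshift 4 8 i)) ->
  (forall i : 'I_4, P (@rshift 4 8 (@lshift 4 4 i))) ->
  (forall i : 'I_4, P (@rshift 4 8 (@rshift 4 4 i))) -> forall x, P x.
Proof.
move=> h1 h2 h3 x.
case: (@split_ordP 4 8 x) => [i ->|x1 ->]; first exact: h1.
by case: (@split_ordP 4 4 x1) => [i ->|i ->].
Qed.

Lemma MmxE (x y : 'I_12) : Mmx R x y = keval R (M_terms x y) / 26.
Proof.
have lo (i : 'I_4) : ((i %/ 4 = 0)%N * (i %% 4 = i)%N)%type.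
  by split; [rewrite divn_small|rewrite modn_small].
have mid (i : nat) :
    (((4 + i) %/ 4 = (i %/ 4).+1)%N * ((4 + i) %% 4 = i %% 4)%N)%type.
  by split; [rewrite divnDl|rewrite modnDl].
have negE (X : 'M[R]_4) i j : (- X) i j = - X i j by rewrite mxE.
pose cE := (@col_mxEu R 4 8 12, @col_mxEd R 4 8 12,
            @col_mxEu R 4 4 12, @col_mxEd R 4 4 12).
pose rE := (@row_mxEl R 4 4 8, @row_mxEr R 4 4 8,
            @row_mxEl R 4 4 4, @row_mxEr R 4 4 4).
move: x y; do 2!apply: ord12_split => ?;
  rewrite /Mmx !cE !rE ?negE ?(AmxE, BmxE, CmxE);
  rewrite /M_terms keval_scale /= !(lo, mid) /=; ring.
Qed.
End FinalTerms.

(** * The level 13 block compared with V and M *)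

Section Level13Identities.
Variable R : realType.

Definition v_terms : seq kterms :=
  [:: cos_terms 2 0 2 2 2 0; cos_terms (-4) 0 2 (-4) 2 1;
      cos_terms 2 0 (-4) 2 (-4) (-1)].

(* The doubled list makes the index of [v_terms] cyclic. *)
Definition V_terms (k x : nat) : kterms :=
  kscale (nth 0 [:: 1; -1; -1] (x %/ 4))
    (nth [::] (v_terms ++ v_terms) (k + x %/ 4)).

Lemma VmxE (k : 'I_3) (x : 'I_12) : Vmx R k x = keval R (V_terms k x) / 26.
Proof.
have lo (i : 'I_4) : (i %/ 4 = 0)%N by rewrite divn_small.
have mid (i : nat) : ((4 + i) %/ 4 = (i %/ 4).+1)%N by rewrite divnDl.
rewrite /V_terms keval_scale -mulrA.
set v := fun i => keval R (nth [::] (v_terms ++ v_terms) i) / 26.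
have v0 : v 0%N = 2 / 13 * (cos65 R 8 + cos65 R 18 + cos65 R 20 - cos65 R 21
    + cos65 R 25 + cos65 R 30 - cos65 R 31) by rewrite /v cos_termsE; field.
have v1 : v 1%N = 13^-1 * (1 - 4 * cos65 R 8 - 4 * cos65 R 18 + 2 * cos65 R 20
    + 4 * cos65 R 21 - 4 * cos65 R 25 + 2 * cos65 R 30 + 4 * cos65 R 31).
  by rewrite /v cos_termsE; field.
have v2 : v 2%N = 13^-1 * (-1 + 2 * cos65 R 8 + 2 * cos65 R 18 - 4 * cos65 R 20
    - 2 * cos65 R 21 + 2 * cos65 R 25 - 4 * cos65 R 30 - 2 * cos65 R 31).
  by rewrite /v cos_termsE; field.
pose rE := (@row_mxEl R 3 4 8, @row_mxEr R 3 4 8,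
            @row_mxEl R 3 4 4, @row_mxEr R 3 4 4).
move: x; apply: ord12_split => x; rewrite /Vmx !rE !mxE /= !(lo, mid) -/(v _);
  rewrite !(addn0, addn1, addn2) -v0 -v1 -v2;
  case: k => [[|[|[|k]]] hk] //=;
  by rewrite -?[v 3]/(v 0%N) -?[v 4]/(v 1%N); ring.
Qed.

(* The values of [13 t_x] for x in gamma, delta, epsilon: the rows of S14 with
   the same eigenvalues. *)
Definition index13 : seq nat := [:: 9; 6; 4; 7; 3; 2; 10; 11; 1; 5; 12; 8].

Definition match13 (x : 'I_12) : 'I_14 := inord (nth 0 index13 x)%N.

(* Conjugation by these signs takes the matched part of S14 to M. *)
Definition sign13 (x : nat) : int :=
  nth 0 [:: 1; 1; -1; -1; -1; 1; -1; 1; 1; 1; 1; 1] x.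

Lemma match13E x : match13 x = nth 0%N index13 x :> nat.
Proof.
rewrite inordK //; apply: (@allP _ (fun n => n < 14)%N index13) => //.
by rewrite mem_nth.
Qed.

Lemma sign13_sq (x : 'I_12) : sign13 x * sign13 x = 1.
Proof. by apply/eqP; case: x; do 12?[case=> //]. Qed.

Lemma iota_allP n (P : pred nat) : all P (iota 0 n) -> forall i : 'I_n, P i.
Proof. by move=> /allP h i; apply: h; rewrite mem_iota add0n ltn_ord. Qed.

Lemma iota_all2P m n (P : nat -> pred nat) :
  all (fun i => all (P i) (iota 0 n)) (iota 0 m) ->
  forall (i : 'I_m) (j : 'I_n), P i j.
Proof. by move=> /iota_allP h i; apply: iota_allP. Qed.

(** Both sides are encoded over 26, so 144 coordinate checks suffice. Together with QS = S'Q this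
    gives r_x S_xy = M_xy r_y on the last twelve labels. *)
Lemma S14_M (x y : 'I_12) :
  S14 R (match13 x) (match13 y) = (sign13 x * sign13 y)%:~R * Mmx R x y.
Proof.
rewrite mxE S14_entryE !match13E MmxE mulrA -keval_scale; congr (_ / _).
apply: keval_eq; apply: (@iota_all2P 12 12 (fun i j => keq
  (S14_terms (nth Lzero labels13 (nth 0%N index13 i))
             (nth Lzero labels13 (nth 0%N index13 j)))
  (kscale (sign13 i * sign13 j) (M_terms i j)))).
by vm_compute.
Qed.

(** The labels 0 and 0' carry the eigenvalue 1; their columns couple the last twelve labels to the
    omega columns of Q. *)
Lemma S14_col0 (x : 'I_12) :
  S14 R (match13 x) ord0 = - (sign13 x)%:~R * Vmx R ord0 x.
Proof.
rewrite mxE S14_entryE !match13E VmxE -rmorphN mulrA -keval_scale.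
congr (_ / _); apply: keval_eq; apply: (@iota_allP 12 (fun i => keq
  (S14_terms (nth Lzero labels13 (nth 0%N index13 i)) Lzero)
  (kscale (- sign13 i) (V_terms 0 i)))).
by vm_compute.
Qed.

Lemma S14_col13 (x : 'I_12) :
  S14 R (match13 x) ord_max = - (sign13 x)%:~R * Vmx R (inord 1) x.
Proof.
rewrite mxE S14_entryE !match13E VmxE -rmorphN mulrA -keval_scale inordK //.
congr (_ / _); apply: keval_eq; apply: (@iota_allP 12 (fun i => keq
  (S14_terms (nth Lzero labels13 (nth 0%N index13 i)) Lzero')
  (kscale (- sign13 i) (V_terms 1 i)))).
by vm_compute.
Qed.

Lemma sum_sqr_keval (l : seq kterms) :
  keval R (flatten [seq kmul t t | t <- l]) = \sum_(t <- l) keval R t ^+ 2.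
Proof. by rewrite keval_flatten; apply: eq_bigr => t _; rewrite kevalM. Qed.

(** The omega and last twelve columns already account for the full norm 1 of such a row of S, which
    leaves norm zero for the alpha columns. *)
Lemma norm_VM (x : 'I_12) :
  \sum_(k < 3) Vmx R k x ^+ 2 + \sum_(y < 12) Mmx R x y ^+ 2 = 1.
Proof.
pose l := [seq V_terms k x | k <- iota 0 3]
  ++ [seq M_terms x y | y <- iota 0 12].
(* The value of 338 [kappa 0] is 26 squared, the common denominator of the squares. *)
have -> : 1 = keval R [:: (338, 0%N)] / 26 ^+ 2.
  by rewrite keval_cons keval_nil kappa0; field.
rewrite (@keval_eq _ [:: (338, 0%N)] (flatten [seq kmul t t | t <- l])).
  rewrite sum_sqr_keval big_cat mulrDl; congr (_ + _).
    rewrite big_map -[iota 0 3]/(index_iota 0 3) big_mkord mulr_suml.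
    by apply: eq_bigr => k _; rewrite VmxE expr_div_n.
  rewrite big_map -[iota 0 12]/(index_iota 0 12) big_mkord mulr_suml.
  by apply: eq_bigr => k _; rewrite MmxE expr_div_n.
apply: (@iota_allP 12 (fun i => keq [:: (338, 0%N)] (flatten
  [seq kmul t t | t <- [seq V_terms k i | k <- iota 0 3] ++
                       [seq M_terms i y | y <- iota 0 12]]))).
by vm_compute.
Qed.

(** These sums are the omega part of the two eigenvector equations in the last twelve rows. *)
Lemma sum_V (x : 'I_12) : \sum_(k < 3) Vmx R k x = 0.
Proof.
transitivity (keval R [::] / 26); last by rewrite keval_nil mul0r.
rewrite (@keval_eq _ [::] (flatten [seq V_terms k x | k <- iota 0 3])).
  rewrite keval_flatten -[iota 0 3]/(index_iota 0 3) big_mkord mulr_suml.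
  by apply: eq_bigr => k _; rewrite VmxE.
apply: (@iota_allP 12 (fun i => keq [::]
  (flatten [seq V_terms k i | k <- iota 0 3]))).
by vm_compute.
Qed.

(** As v_0 + v_1 + v_2 = 0, this form is minus the determinant of (v_0, v_1) and (v_1, v_2); its
    value shows that these vectors are independent. *)
Lemma Vmx_minor :
  let v k := keval R (nth [::] v_terms k) / 26 in
  v 0%N ^+ 2 + v 0%N * v 1%N + v 1%N ^+ 2 = 13^-1.
Proof.
have E (a b : kterms) : keval R (kmul a a ++ kmul a b ++ kmul b b) =
    keval R a ^+ 2 + keval R a * keval R b + keval R b ^+ 2.
  by rewrite !keval_cat !kevalM; ring.
have := E (nth [::] v_terms 0) (nth [::] v_terms 1).
(* The value of 26 [kappa 0] is 52, that is, 26 ^ 2 / 13. *)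
rewrite (@keval_eq _ _ [:: (26, 0%N)]); last by vm_compute.
rewrite keval_cons keval_nil kappa0 /= => h.
by transitivity ((keval R (nth [::] v_terms 0) ^+ 2
  + keval R (nth [::] v_terms 0) * keval R (nth [::] v_terms 1)
  + keval R (nth [::] v_terms 1) ^+ 2) / 26 ^+ 2); [field|rewrite -h; field].
Qed.

End Level13Identities.

(** * The field Q(z) and its automorphisms *)

Section Adjunction.
Variables (R : realType) (z : R[i]).
Local Notation K := (Qadjoin z).

Lemma Qadjoin_gen : z \in K.
Proof. by apply: mem_set => F. Qed.

Lemma Qadjoin1 : 1 \in K.
Proof. by apply: mem_set => F [F1 _ _] _. Qed.

Lemma QadjoinB x y : x \in K -> y \in K -> x - y \in K.
Proof.
move=> /set_mem Kx /set_mem Ky; apply: mem_set => F F_ring zF.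
by case: (F_ring) => _ FB _; apply: FB; [apply: Kx|apply: Ky].
Qed.

Lemma QadjoinF x y : x \in K -> y \in K -> x / y \in K.
Proof.
move=> /set_mem Kx /set_mem Ky; apply: mem_set => F F_ring zF.
by case: (F_ring) => _ _ FF; apply: FF; [apply: Kx|apply: Ky].
Qed.

Lemma Qadjoin0 : 0 \in K.
Proof. by rewrite -(subrr 1) QadjoinB ?Qadjoin1. Qed.

Lemma QadjoinN x : x \in K -> - x \in K.
Proof. by move=> Kx; rewrite -sub0r QadjoinB ?Qadjoin0. Qed.

Lemma QadjoinD x y : x \in K -> y \in K -> x + y \in K.
Proof. by move=> Kx Ky; rewrite -[y]opprK QadjoinB ?QadjoinN. Qed.

Lemma QadjoinV x : x \in K -> x^-1 \in K.
Proof. by move=> Kx; rewrite -div1r QadjoinF ?Qadjoin1. Qed.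

Lemma QadjoinM x y : x \in K -> y \in K -> x * y \in K.
Proof. by move=> Kx Ky; rewrite -[y]invrK QadjoinF ?QadjoinV. Qed.

Lemma Qadjoin_nat n : n%:R \in K.
Proof.
by elim: n => [|n IHn]; rewrite ?Qadjoin0 // -natr1 QadjoinD ?Qadjoin1.
Qed.

Lemma Qadjoin_int (m : int) : m%:~R \in K.
Proof.
by case: m => n; rewrite ?NegzE ?rmorphN /= ?QadjoinN ?Qadjoin_nat.
Qed.

Lemma QadjoinX x n : x \in K -> x ^+ n \in K.
Proof.
by move=> Kx; elim: n => [|n IHn]; rewrite ?Qadjoin1 // exprS QadjoinM.
Qed.

Variable s : R[i] -> R[i].
Hypothesis s_aut : field_automorphism K s.

Lemma autD x y : x \in K -> y \in K -> s (x + y) = s x + s y.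
Proof. by case: s_aut => _ _ sD _; apply: sD. Qed.

Lemma autM x y : x \in K -> y \in K -> s (x * y) = s x * s y.
Proof. by case: s_aut => _ _ _ sM; apply: sM. Qed.

Lemma aut1 : s 1 = 1.
Proof. by case: s_aut. Qed.

Lemma aut0 : s 0 = 0.
Proof.
by apply: (addrI (s 0)); rewrite -autD ?Qadjoin0 // !addr0.
Qed.

Lemma autN x : x \in K -> s (- x) = - s x.
Proof.
move=> Kx; apply: (addrI (s x)).
by rewrite -autD ?QadjoinN // !subrr aut0.
Qed.

Lemma aut_nat n : s n%:R = n%:R.
Proof.
elim: n => [|n IHn]; first exact: aut0.
by rewrite -natr1 autD ?Qadjoin_nat ?Qadjoin1 // IHn aut1.
Qed.

Lemma aut_int (m : int) : s m%:~R = m%:~R.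
Proof.
by case: m => n; rewrite ?NegzE ?rmorphN /= ?autN ?Qadjoin_nat // aut_nat.
Qed.

Lemma autV_nat n : s n%:R^-1 = n%:R^-1.
Proof.
case: n => [|n]; first by rewrite invr0 aut0.
have n0 : n.+1%:R != 0 :> R[i] by rewrite pnatr_eq0.
apply: (mulfI n0); rewrite -{1}(aut_nat n.+1) -autM ?QadjoinV ?Qadjoin_nat //.
by rewrite mulfV ?aut1.
Qed.

Lemma autX x n : x \in K -> s (x ^+ n) = s x ^+ n.
Proof.
move=> Kx; elim: n => [|n IHn]; first exact: aut1.
by rewrite !exprS autM ?QadjoinX // IHn.
Qed.

End Adjunction.

(** * Galois action on the first row of S *)

Section FirstRows.
Variable R : realType.
Local Notation C := R[i].
Local Notation zeta := (zeta R).
Local Notation zeta' := (zeta' R).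

(** A polynomial in [xi R 13], with 12 n in place of -n, is a form on which tau can be evaluated. *)
Lemma kappaC n : (kappa R n)%:C = xi R 13 ^+ n + xi R 13 ^+ (12 * n).
Proof.
have e (x : R) : (2 * cos x)%:C = expi x + expi (- x).
  rewrite /expi cosN sinN; apply/eqP; rewrite eq_complex /= subrr eqxx andbT.
  by apply/eqP; ring.
rewrite /kappa e -xi_pow //; congr (_ + _); rewrite xi_pow //.
have -> : - (2 * pi * n%:R / 13) =
    2 * pi * (12 * n)%:R / 13 + - (2 * pi * n%:R) :> R by rewrite natrM; field.
rewrite expiD; suff -> : expi (- (2 * pi * n%:R)) = 1 :> C by rewrite mulr1.
apply: (mulfI (expi_neq0 (2 * pi * n%:R))); rewrite -expiD subrr expi0 mulr1.
by rewrite expi_natmul expi2pi expr1n.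
Qed.

Lemma zetaE : zeta = (kappa R 1 + kappa R 5)%:C.
Proof.
by rewrite /Defs.zeta /kappa; congr (_ + _)%:C; congr (2 * cos _); field.
Qed.

Lemma zeta'E : zeta' = (kappa R 2 + kappa R 3)%:C.
Proof.
by rewrite /Defs.zeta' /kappa; congr (_ + _)%:C; congr (2 * cos _); field.
Qed.

(** This puts zeta' into Q(zeta), where sigma agrees with tau. *)
Lemma zeta'_poly : zeta' = 2 - 2 * zeta - zeta * zeta.
Proof.
pose z : kterms := [:: (1, 1%N); (1, 5%N)].
have h := @keval_eq R (z ++ z ++ kmul z z ++ [:: (1, 2%N); (1, 3%N)])
  [:: (1, 0%N)].
have {h} : keval R (z ++ z ++ kmul z z ++ [:: (1, 2%N); (1, 3%N)]) = 2.
  by rewrite h ?keval_cons ?keval_nil ?kappa0 ?mul1r ?addr0; last by vm_compute.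
have zE : keval R z = kappa R 1 + kappa R 5.
  by rewrite !keval_cons keval_nil !mul1r addr0.
have E a b : keval R (a ++ a ++ kmul a a ++ b) =
    2 * keval R a + keval R a ^+ 2 + keval R b.
  by rewrite !keval_cat kevalM; ring.
rewrite E zE !keval_cons keval_nil => h.
transitivity ((2 - 2 * (kappa R 1 + kappa R 5)
  - (kappa R 1 + kappa R 5) * (kappa R 1 + kappa R 5))%:C).
  by rewrite zeta'E; congr _%:C; lra.
by rewrite zetaE 2!rmorphB !rmorphM rmorph_nat.
Qed.

(* [(a, b, c, n)] encodes [(a + b zeta + c zeta') / n]. *)
Definition zlin (t : int * int * int * nat) : C :=
  let: (a, b, c, n) := t in (a%:~R + b%:~R * zeta + c%:~R * zeta') / n%:R.

(** The action of sigma on coordinates, read off from zeta |-> zeta' and zeta' |-> -1 - zeta -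
    zeta'. *)
Definition zstep (t : int * int * int * nat) : int * int * int * nat :=
  let: (a, b, c, n) := t in (a - c, - c, b - c, n).

Definition zterms (t : int * int * int * nat) : kterms :=
  let: (a, b, c, _) := t in
  [:: (a, 0%N); (2 * b, 1%N); (2 * b, 5%N); (2 * c, 2%N); (2 * c, 3%N)].

Lemma zlinE a b c n :
  zlin (a, b, c, n) = (keval R (zterms (a, b, c, n)) / (2 * n%:R))%:C.
Proof.
transitivity (((a%:~R + b%:~R * (kappa R 1 + kappa R 5)
  + c%:~R * (kappa R 2 + kappa R 3)) / n%:R)%:C).
  rewrite rmorphM fmorphV rmorph_nat 2!rmorphD !rmorphM !rmorph_int.
  by rewrite /zlin zetaE zeta'E.
rewrite !keval_cons keval_nil kappa0 invfM mulrA; congr (_ * _)%:C.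
by rewrite !intrM; field.
Qed.

Definition row0_triples : seq (int * int * int * nat) :=
  [:: (7, 0, -5, 65%N); (12, 5, 5, 65%N); (7, -5, 0, 65%N)]
  ++ nseq 7 (1, 0, 0, 5%N) ++ nseq 4 (1, 1, 2, 13%N)
  ++ nseq 4 (1, 2, 1, 13%N) ++ nseq 4 (0, -1, 1, 13%N).

Lemma S_row0E : S_row0 R = [seq zlin t | t <- row0_triples].
Proof.
rewrite /S_row0 /row0_triples !map_cat !map_nseq.
do 4?[congr (_ ++ _)].
- by rewrite /=; congr [:: _; _; _]; field.
all: by congr (nseq _ _); rewrite /=; field.
Qed.

Variable sigma : C -> C.
Hypothesis sigmaP : is_sigma sigma.

Lemma zeta'_Qadjoin : zeta' \in Qadjoin zeta.
Proof.
by rewrite zeta'_poly !(QadjoinB, QadjoinM, Qadjoin_nat, Qadjoin_gen).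
Qed.

(** Since tau sends [kappa n] to [kappa (3 * n)], it maps kappa_1 + kappa_5 to kappa_3 + kappa_2 and
    kappa_2 + kappa_3 to kappa_6 + kappa_4; [sum_kappa] rewrites the latter. *)
Lemma sigma_zeta : sigma zeta = zeta' /\ sigma zeta' = -1 - zeta - zeta'.
Proof.
case: sigmaP => _ [tau [tau_aut tau_xi sigma_tau]].
have tau_kappa n : tau (kappa R n)%:C = (kappa R (3 * n))%:C.
  rewrite !kappaC (autD tau_aut) ?(QadjoinX, Qadjoin_gen) //.
  by rewrite !(autX tau_aut) ?Qadjoin_gen // tau_xi -!exprM mulnCA.
have kappa_in n : (kappa R n)%:C \in Qadjoin (xi R 13).
  by rewrite kappaC QadjoinD ?QadjoinX ?Qadjoin_gen.
split.
  rewrite (sigma_tau _ (Qadjoin_gen _)) zetaE rmorphD.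
  rewrite (autD tau_aut (kappa_in _) (kappa_in _)) !tau_kappa zeta'E -rmorphD.
  by rewrite -(kappa_mod _ (3 * 1)) -(kappa_mod _ (3 * 5)) /= addrC.
rewrite (sigma_tau _ zeta'_Qadjoin) zetaE zeta'E rmorphD.
rewrite (autD tau_aut (kappa_in _) (kappa_in _)).
transitivity ((-1 - (kappa R 1 + kappa R 5) - (kappa R 2 + kappa R 3))%:C).
  rewrite !tau_kappa -rmorphD -[kappa _ (3 * 3)]kappaB //=; congr _%:C.
  by have := sum_kappa R; rewrite unlock /= => h; lra.
by rewrite 2!rmorphB rmorphN rmorph1 [X in _ - X]rmorphD.
Qed.

Lemma sigma_zlin t : sigma (zlin t) = zlin (zstep t).
Proof.
case: t => [[[a b] c] n]; rewrite /zlin /=.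
case: sigmaP => s_aut _; case: sigma_zeta => s_z s_z'.
have K := (Qadjoin_int, Qadjoin_gen, zeta'_Qadjoin).
rewrite (autM s_aut) ?(QadjoinD, QadjoinM, QadjoinV, Qadjoin_nat, K) //.
rewrite (autV_nat s_aut) !(autD s_aut) ?(QadjoinD, QadjoinM, K) //.
rewrite !(autM s_aut) ?K // !(aut_int s_aut) s_z s_z'; congr (_ / _).
by rewrite !rmorphB rmorphN; ring.
Qed.

Lemma iter_sigma_zlin i t : iter i sigma (zlin t) = zlin (iter i zstep t).
Proof. by elim: i => //= i ->; rewrite sigma_zlin. Qed.

Lemma iter_sigma_row0 i x : (x < 22)%N ->
  iter i sigma (S_row0 R)`_x =
  zlin (iter i zstep (nth (0, 0, 0, 0%N) row0_triples x)).
Proof.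
by move=> x_lt; rewrite -iter_sigma_zlin S_row0E (nth_map (0, 0, 0, 0%N)).
Qed.

End FirstRows.

(** * Entries of the final matrix and of the level 5 block *)

Section Entries.
Variable R : realType.
Local Notation C := R[i].

(* gamma, delta and epsilon together *)
Definition rest (x : 'I_12) : 'I_22 := @rshift 10 12 x.

Lemma ord22_split (P : 'I_22 -> Type) :
  (forall i, P (omega i)) -> (forall i, P (alpha i)) ->
  (forall j, P (beta j)) -> (forall x, P (rest x)) -> forall x, P x.
Proof.
move=> hO hA hB hR x.
case: (@split_ordP 10 12 x) => [y ->|y ->]; last exact: hR.
case: (@split_ordP 6 4 y) => [z ->|j ->]; last first.
  have -> : @lshift 10 12 (@rshift 6 4 j) = beta j :> 'I_22 by apply: val_inj.
  exact: hB.
case: (@split_ordP 3 3 z) => [i ->|i ->].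
  have -> : @lshift 10 12 (@lshift 6 4 (@lshift 3 3 i)) = omega i :> 'I_22.
    exact: val_inj.
  exact: hO.
have -> : @lshift 10 12 (@lshift 6 4 (@rshift 3 3 i)) = alpha i :> 'I_22.
  exact: val_inj.
exact: hA.
Qed.

(** [beta] follows the splitting 6 + 16, whereas [Sfinal] is nested along 3 + (3 + (4 + 12)). *)
Lemma beta_block j : beta j = @rshift 3 19 (@rshift 3 16 (@lshift 4 12 j)).
Proof. exact: val_inj. Qed.

Lemma rest_block x : rest x = @rshift 3 19 (@rshift 3 16 (@rshift 4 12 x)).
Proof. exact: val_inj. Qed.

Let blockE := (beta_block, rest_block,
  (@col_mxEu R 3 19 22, @col_mxEd R 3 19 22, @col_mxEu R 3 16 22,
   @col_mxEd R 3 16 22, @col_mxEu R 4 12 22, @col_mxEd R 4 12 22),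
  (@row_mxEl R 3 3 19, @row_mxEr R 3 3 19, @row_mxEl R 3 3 16,
   @row_mxEr R 3 3 16, @row_mxEl R 3 4 12, @row_mxEr R 3 4 12),
  (@row_mxEl R 4 3 19, @row_mxEr R 4 3 19, @row_mxEl R 4 3 16,
   @row_mxEr R 4 3 16, @row_mxEl R 4 4 12, @row_mxEr R 4 4 12),
  (@row_mxEl R 12 3 19, @row_mxEr R 12 3 19, @row_mxEl R 12 3 16,
   @row_mxEr R 12 3 16, @row_mxEl R 12 4 12, @row_mxEr R 12 4 12)).

Local Notation F := (Sfinal R).

Lemma Sfinal_omega_omega i j : F (omega i) (omega j) = Umx R i j.
Proof. by rewrite /Sfinal /omega !blockE. Qed.

Lemma Sfinal_omega_alpha i j : F (omega i) (alpha j) = 1 / 5.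
Proof. by rewrite /Sfinal /omega /alpha !blockE mxE. Qed.

Lemma Sfinal_omega_beta i j : F (omega i) (beta j) = 1 / 5.
Proof. by rewrite /Sfinal /omega !blockE mxE. Qed.

Lemma Sfinal_omega_rest i x : F (omega i) (rest x) = Vmx R i x.
Proof. by rewrite /Sfinal /omega !blockE. Qed.

Lemma Sfinal_alpha_alpha i j :
  F (alpha i) (alpha j) = (i == j)%:R - 1 / 5.
Proof. by rewrite /Sfinal /alpha !blockE !mxE. Qed.

Lemma Sfinal_alpha_beta i j : F (alpha i) (beta j) = - (1 / 5).
Proof. by rewrite /Sfinal /alpha !blockE !mxE. Qed.

Lemma Sfinal_alpha_rest i x : F (alpha i) (rest x) = 0.
Proof. by rewrite /Sfinal /alpha !blockE !mxE. Qed.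

Lemma Sfinal_beta_beta i j : F (beta i) (beta j) = Wmx R i j.
Proof. by rewrite /Sfinal !blockE. Qed.

Lemma Sfinal_beta_rest i x : F (beta i) (rest x) = 0.
Proof. by rewrite /Sfinal !blockE mxE. Qed.

Lemma Sfinal_rest_rest x y : F (rest x) (rest y) = Mmx R x y.
Proof. by rewrite /Sfinal !blockE. Qed.

Lemma Wmx_sym i j : Wmx R i j = Wmx R j i.
Proof.
by rewrite !mxE; case: i j => [[|[|[|[|i]]]] hi] [[|[|[|[|j]]]] hj].
Qed.

Lemma Umx_sym i j : Umx R i j = Umx R j i.
Proof. by rewrite !mxE; case: i j => [[|[|[|i]]] hi] [[|[|[|j]]] hj]. Qed.

Lemma Mmx_sym x y : Mmx R x y = Mmx R y x.
Proof.
rewrite !MmxE; congr (_ / _); apply: keval_eq.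
apply: (@iota_all2P 12 12 (fun i j => keq (M_terms i j) (M_terms j i))).
by vm_compute.
Qed.

Lemma Sfinal_sym x y : F x y = F y x.
Proof.
move: x y; apply: ord22_split => i; apply: ord22_split => j;
  rewrite ?(Sfinal_omega_omega, Sfinal_alpha_alpha, Sfinal_beta_beta,
            Sfinal_rest_rest);
  rewrite 1?Umx_sym 1?Wmx_sym 1?Mmx_sym 1?(eq_sym i) //;
  by rewrite /Sfinal /omega /alpha !blockE !mxE.
Qed.

Definition u_terms : seq kterms :=
  [:: cos_terms 0 0 (-10) 0 (-10) 7; cos_terms 10 0 0 10 0 7;
      cos_terms (-10) 0 10 (-10) 10 12].

Lemma UmxE (i j : 'I_3) :
  Umx R i j = keval R (nth [::] u_terms ((i + j) %% 3)) / 130.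
Proof.
have E t : keval R t / 130 = (keval R t / 26) / 5 by field.
rewrite E mxE; case: i j => [[|[|[|i]]] hi] [[|[|[|j]]] hj] //;
  by rewrite [nth [::] _ _]/= cos_termsE /=; field.
Qed.

Lemma zlin_iterE i t :
  zlin R (iter i zstep t) =
  (keval R (zterms (iter i zstep t)) / (2 * t.2%:R))%:C.
Proof.
have -> : t.2 = (iter i zstep t).2.
  by elim: i => //= i ->; case: (iter i _ t) => [[[a b] c] n].
by case: (iter i zstep t) => [[[a b] c] n]; rewrite zlinE.
Qed.

(** Sigma moves u_1, u_2, u_3 and v_1, v_2, v_3 one step along their cycles; the cases i = 0, 1, 2
    are compared in coordinates. *)
Lemma first_rows sigma (i : 'I_3) (x : 'I_22) : is_sigma sigma ->
  iter i sigma (S_row0 R)`_x = (F (omega i) x)%:C.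
Proof.
move=> sigmaP; rewrite (iter_sigma_row0 sigmaP) // zlin_iterE; congr _%:C.
pose t k := nth (0, 0, 0, 0%N) row0_triples k.
(* The number 1/5 is rational, so every power of sigma fixes it. *)
have fifth k : t k = (1, 0, 0, 5%N) ->
    keval R (zterms (iter i zstep (t k))) / (2 * (t k).2%:R) = 1 / 5.
  move=> ->; rewrite [iter _ _ _](_ : _ = (1, 0, 0, 5%N)).
    by rewrite !keval_cons keval_nil kappa0 /=; field.
  by elim: (i : nat) => //= k' ->.
rewrite -/(t x); elim/ord22_split: x => [j|j|j|x].
- rewrite Sfinal_omega_omega UmxE.
  have -> : (t (omega j)).2 = 65%N by case: j => [[|[|[|j]]] hj].
  have -> : 2 * 65%:R = 130 :> R by ring.
  congr (_ / _); apply: keval_eq; apply: (@iota_all2P 3 3 (fun i j => keq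
    (zterms (iter i zstep (t j))) (nth [::] u_terms ((i + j) %% 3)))).
  by vm_compute.
- rewrite Sfinal_omega_alpha; apply: fifth.
  by case: j => [[|[|[|j]]] hj].
- rewrite Sfinal_omega_beta; apply: fifth.
  by case: j => [[|[|[|[|j]]]] hj].
rewrite Sfinal_omega_rest VmxE.
have -> : (t (rest x)).2 = 13%N by case: x; do 12?[case=> //].
have -> : 2 * 13%:R = 26 :> R by ring.
congr (_ / _); apply: keval_eq; apply: (@iota_all2P 3 12 (fun i j => keq
  (zterms (iter i zstep (t (10 + j)%N))) (V_terms i j))).
by vm_compute.
Qed.

(** Label 0 of the level 5 block has eigenvalue 1, so the four betas match the labels 1 to 4. *)
Definition match5 (j : 'I_4) : 'I_5 := lift ord0 j.

(** For c = cos (2 pi / 5), the duplication formula and the vanishing sum of the fifth roots of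
    unity give (4 c + 1) ^ 2 = 5; positivity of c selects the root. *)
Lemma cos_2pi_5 : 2 * cos (2 * pi / 5) = (Num.sqrt 5 - 1) / 2 :> R /\
  2 * cos (4 * pi / 5) = (- Num.sqrt 5 - 1) / 2 :> R.
Proof.
set c := cos (2 * pi / 5); set c' := cos (4 * pi / 5).
have c_pos : 0 < c.
  by apply: cos_gt0_pihalf; have := pi_gt0 R; lra.
have dbl : c' = 2 * c ^+ 2 - 1.
  rewrite /c' [4 * pi / 5](_ : _ = (2 * pi / 5) *+ 2).
    by rewrite cos_mulr2n -/c; ring.
  by rewrite -mulr_natl; field.
have sum : 1 + 2 * c + 2 * c' = 0.
  have := @sum_cos_rotations R 5 0 isT; rewrite !big_ord_recr big_ord0 /=.
  rewrite !add0r mulr0 mul0r cos0 mulr1 -/c.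
  have -> : cos (2 * pi * 2 / 5) = c' by congr cos; field.
  have -> : cos (2 * pi * 3 / 5) = c'.
    by rewrite -cosN -(@cosD_2pi_natmul R _ 1); congr cos; field.
  have -> : cos (2 * pi * 4 / 5) = c.
    by rewrite -cosN -(@cosD_2pi_natmul R _ 1); congr cos; field.
  lra.
have r_eq : Num.sqrt 5 = 4 * c + 1 :> R.
  rewrite (_ : 5 = (4 * c + 1) ^+ 2) ?sqrtr_sqr ?ger0_norm //; first lra.
  nra.
by rewrite r_eq; split; lra.
Qed.

Lemma S5_W i j : S5 R (match5 i) (match5 j) = Wmx R i j.
Proof.
rewrite !mxE; case: cos_2pi_5 => -> ->.
by case: i j => [[|[|[|[|i]]]] hi] [[|[|[|[|j]]]] hj] //=; field.
Qed.

Lemma S5_col0 i : S5 R (match5 i) ord0 = - (1 / 5).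
Proof. by rewrite !mxE; case: i => [[|[|[|[|i]]]] hi] //=; field. Qed.

Lemma S5_row0 i : S5 R ord0 (match5 i) = - (6 / 5).
Proof. by rewrite !mxE; case: i => [[|[|[|[|i]]]] hi] //=; field. Qed.

Lemma S5_00 : S5 R ord0 ord0 = - (1 / 5).
Proof. by rewrite !mxE /=; field. Qed.

End Entries.

(** * Matrices Q with QS = S'Q whose support is restricted by labels a and b *)

Section Intertwiner.
Variables (F : fieldType) (n : nat) (S S' Q : 'M[F]_n) (a b : 'I_n -> nat).
Hypothesis Q_unit : Q \in unitmx.
Hypothesis QS : Q *m S = S' *m Q.
Hypothesis Q_supp : forall i x, b i != a x -> Q i x = 0.

(** Row i of Q is supported at x alone, and an invertible matrix has no zero row. *)
Lemma intertwiner_neq0 i x : (forall k, a k = b i -> k = x) -> Q i x != 0.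
Proof.
move=> ix; apply/eqP => Qix0; have := mulmxV Q_unit.
move=> /matrixP/(_ i i); rewrite !mxE eqxx big1 => [/esym/eqP|k _].
  by rewrite oner_eq0.
have [->|ne] := eqVneq k x; first by rewrite Qix0 mul0r.
rewrite Q_supp ?mul0r //; apply: contra_neq ne => e; exact: ix.
Qed.

(** The support of row i reduces the entry of QS to one term; [intertwine_col] does the same for S'Q
    by the support of a column. *)
Lemma intertwine_row i x y : (forall k, a k = b i -> k = x) ->
  Q i x * S x y = \sum_j S' i j * Q j y.
Proof.
move=> ix; have /matrixP/(_ i y) := QS; rewrite !mxE => <-.
rewrite (bigD1 x) //= big1 ?addr0 // => k ne.
rewrite Q_supp ?mul0r //; apply: contra_neq ne => e; exact: ix.
Qed.

Lemma intertwine_col i j y : (forall k, b k = a y -> k = j) ->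
  \sum_x Q i x * S x y = S' i j * Q j y.
Proof.
move=> yj; have /matrixP/(_ i y) := QS; rewrite !mxE => ->.
rewrite (bigD1 j) //= big1 ?addr0 // => k ne.
rewrite Q_supp ?mulr0 //; apply: contra_neq ne; exact: yj.
Qed.

Lemma intertwine i j x y : (forall k, a k = b i -> k = x) ->
  (forall k, b k = a y -> k = j) -> Q i x * S x y = S' i j * Q j y.
Proof.
move=> ix yj; rewrite (intertwine_row _ ix) (bigD1 j) //= big1 ?addr0 // =>
  k ne.
rewrite Q_supp ?mulr0 //; apply: contra_neq ne; exact: yj.
Qed.

Lemma intertwiner_trace : \tr S = \tr S'.
Proof.
by rewrite -[S](mulKmx Q_unit) QS mxtrace_mulC mulmxK.
Qed.

End Intertwiner.

(** * Eigenvalues of T and T' as powers of [xi R 65] *)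

Section Eigenvalues.
Variable R : realType.
Local Notation C := R[i].

(* T_x = xi_65 ^ (exponents_x) and T'_i = xi_65 ^ (exponents'_i). *)
Definition exponents : seq nat :=
  [:: 0; 0; 0; 0; 0; 0; 13; 26; 39; 52;
      45; 30; 20; 35; 15; 10; 50; 55; 5; 25; 60; 40]%N.

Definition exponents' : seq nat :=
  [:: 0; 5; 10; 15; 20; 25; 30; 35; 40; 45; 50; 55; 60; 0;
      0; 13; 26; 39; 52; 0; 0; 0]%N.

Definition expo (x : 'I_22) : nat := nth 0%N exponents x.
Definition expo' (i : 'I_22) : nat := nth 0%N exponents' i.

Lemma TmxE : Tmx R = diag_mx (\row_x xi R 65 ^+ expo x).
Proof.
rewrite /Tmx; congr diag_mx; apply/rowP => x; rewrite !mxE xi_pow //.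
have -> : t_exponents R = [seq n%:R / 65 | n <- exponents].
  by rewrite /t_exponents /exponents /=; do 22?[congr (_ :: _); first by field].
by rewrite (nth_map 0%N) // mulrA.
Qed.

Lemma TprimeE : Tprime R = diag_mx (\row_i xi R 65 ^+ expo' i).
Proof.
have e13 l : xi R 13 ^+ l = xi R 65 ^+ (5 * l).
  by rewrite !xi_pow // natrM; congr expi; field.
have e5 l : xi R 5 ^+ l = xi R 65 ^+ (13 * l).
  by rewrite !xi_pow // natrM; congr expi; field.
rewrite /Tprime /T14 /T5 /direct_sum_mx -[1%:M]diag_const_mx -!diag_mx_row.
congr diag_mx; apply/rowP => x; rewrite [RHS]mxE /expo'.
case: (@split_ordP 14 8 x) => [i ->|y ->].
  rewrite (@row_mxEl _ 1 14 8) mxE e13.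
  by case: i; do 14?[case=> //].
rewrite (@row_mxEr _ 1 14 8); case: (@split_ordP 5 3 y) => [i ->|i ->].
  rewrite (@row_mxEl _ 1 5 3) mxE e5.
  by case: i; do 5?[case=> //].
rewrite (@row_mxEr _ 1 5 3) mxE.
by case: i; do 3?[case=> //].
Qed.

(** Entry (i, x) of QT = T'Q multiplies Q_ix by two powers of [xi R 65] with exponents below 65;
    different powers force Q_ix = 0. *)
Lemma intertwiner_support (Q : 'M[C]_22) : Q *m Tmx R = Tprime R *m Q ->
  forall i x, expo' i != expo x -> Q i x = 0.
Proof.
rewrite TmxE TprimeE => /matrixP QT i x ne; have := QT i x.
rewrite mul_mx_diag mul_diag_mx !mxE mulrC => e.
have [//|Q0] := eqVneq (Q i x) 0; case/eqP: ne; apply/esym.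
apply: (@xi_pow_inj R 65); last exact: (mulIf Q0).
  by apply: (@iota_allP 22 (fun k => nth 0%N exponents k < 65)%N).
by apply: (@iota_allP 22 (fun k => nth 0%N exponents' k < 65)%N).
Qed.

End Eigenvalues.

(** * Matching of labels with equal eigenvalues *)

Section BlockIndices.
Variable R : realType.

Definition block14 (l : 'I_14) : 'I_22 := @lshift 14 8 l.
Definition block5 (k : 'I_5) : 'I_22 := @rshift 14 8 (@lshift 5 3 k).

Lemma Sprime_14 l m : Sprime R (block14 l) (block14 m) = (S14 R l m)%:C.
Proof. by rewrite mxE (@block_mxEul _ 14 8 14 8). Qed.

Lemma Sprime_14_r l k : Sprime R (block14 l) (@rshift 14 8 k) = 0.
Proof. by rewrite mxE (@block_mxEur _ 14 8 14 8) mxE rmorph0. Qed.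

Lemma Sprime_5_l k m : Sprime R (block5 k) (block14 m) = 0.
Proof. by rewrite mxE (@block_mxEdl _ 14 8 14 8) mxE rmorph0. Qed.

Lemma Sprime_5 k j : Sprime R (block5 k) (block5 j) = (S5 R k j)%:C.
Proof. by rewrite mxE (@block_mxEdr _ 14 8 14 8) (@block_mxEul _ 5 3 5 3). Qed.

Lemma Sprime_5_r k j :
  Sprime R (block5 k) (@rshift 14 8 (@rshift 5 3 j)) = 0.
Proof.
by rewrite mxE (@block_mxEdr _ 14 8 14 8) (@block_mxEur _ 5 3 5 3) mxE rmorph0.
Qed.

Lemma sum_blocks (F : 'I_22 -> R[i]) : \sum_x F x =
  \sum_i F (omega i) + \sum_i F (alpha i) + \sum_j F (beta j)
  + \sum_x F (rest x).
Proof.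
rewrite (@big_split_ord _ _ _ 3 19) (@big_split_ord _ _ _ 3 16).
rewrite (@big_split_ord _ _ _ 4 12) /= -!addrA.
do 2!congr (_ + _); congr (_ + _); apply: eq_bigr => j _.
  by rewrite beta_block.
by rewrite rest_block.
Qed.

(** Simplicity of these eigenvalues is read off the list of exponents: in T here, and in T' in
    [expo'_rest]. *)
Lemma expo_rest (x : 'I_12) (k : 'I_22) :
  expo k = expo' (block14 (match13 x)) -> k = rest x.
Proof.
rewrite /expo /expo' /= match13E => /eqP e; apply/val_inj/eqP => /=.
have := @iota_all2P 12 22 (fun x k => (nth 0 exponents k ==
  nth 0 exponents' (nth 0 index13 x)) ==> (k == 10 + x))%N.
by move=> /(_ isT x k); rewrite e.
Qed.

Lemma expo'_rest (x : 'I_12) (k : 'I_22) :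
  expo' k = expo (rest x) -> k = block14 (match13 x).
Proof.
rewrite /expo /expo' /= => /eqP e; apply/val_inj/eqP => /=; rewrite match13E.
have := @iota_all2P 12 22 (fun x k => (nth 0 exponents' k ==
  nth 0 exponents (10 + x)) ==> (k == nth 0 index13 x))%N.
by move=> /(_ isT x k); rewrite e.
Qed.

Lemma expo_beta (j : 'I_4) (k : 'I_22) :
  expo k = expo' (block5 (match5 j)) -> k = beta j.
Proof.
rewrite /expo /expo' /= => /eqP e; apply/val_inj/eqP => /=.
(* The offset 14 + 1 skips the level 13 labels and the label 0 of the level 5 block. *)
have := @iota_all2P 4 22 (fun x k => (nth 0 exponents k ==
  nth 0 exponents' (14 + (1 + x))) ==> (k == 6 + x))%N.
by move=> /(_ isT j k); rewrite e.
Qed.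

Lemma expo'_beta (j : 'I_4) (k : 'I_22) :
  expo' k = expo (beta j) -> k = block5 (match5 j).
Proof.
rewrite /expo /expo' /= => /eqP e; apply/val_inj/eqP => /=.
have := @iota_all2P 4 22 (fun x k => (nth 0 exponents' k ==
  nth 0 exponents (6 + x)) ==> (k == 14 + (1 + x)))%N.
by move=> /(_ isT j k); rewrite e.
Qed.

Lemma expo'_eq0_14 (l : 'I_14) :
  expo' (block14 l) = 0%N -> l = ord0 \/ l = ord_max.
Proof.
move=> /eqP e; have := @iota_allP 14
  (fun l => (nth 0 exponents' l == 0) ==> ((l == 0) || (l == 13)))%N.
move=> /(_ isT l); rewrite [X in X ==> _]e /= => /orP[]/eqP h; [left|right];
  exact: val_inj.
Qed.

Lemma expo'_eq0_5 (k : 'I_5) : expo' (block5 k) = 0%N -> k = ord0.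
Proof.
move=> /eqP e; have := @iota_allP 5
  (fun l => (nth 0 exponents' (14 + l) == 0) ==> (l == 0))%N.
by move=> /(_ isT k); rewrite [X in X ==> _]e /= => /eqP h; apply: val_inj.
Qed.

End BlockIndices.

(** The vectors w_1 = (v1, v2), w_2 = (v2, v3), w_3 = (v3, v1) are eigenvectors of one 2 x 2 matrix
    and add up to zero. Hence (r1 - r3) w_1 + (r2 - r3) w_2 = 0, and the determinant of w_1, w_2 is
    nonzero by the second hypothesis. *)
Lemma common_eigenvalue (F : fieldType) (v1 v2 v3 p p' o o' r1 r2 r3 : F) :
  v1 + v2 + v3 = 0 -> v1 ^+ 2 + v1 * v2 + v2 ^+ 2 != 0 ->
  r1 * v1 = v1 * p + v2 * p' -> r1 * v2 = v1 * o + v2 * o' ->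
  r2 * v2 = v2 * p + v3 * p' -> r2 * v3 = v2 * o + v3 * o' ->
  r3 * v3 = v3 * p + v1 * p' -> r3 * v1 = v3 * o + v1 * o' ->
  r1 = r3 /\ r2 = r3.
Proof.
move=> v_sum N0 e1 e1' e2 e2' e3 e3'.
have v3E : v3 = - (v1 + v2) by apply/eqP; rewrite -addr_eq0 addrC v_sum.
have h : (r1 - r3) * v1 + (r2 - r3) * v2 = 0.
  rewrite (_ : _ + _ = r1 * v1 + r2 * v2 + r3 * v3); last by rewrite v3E; ring.
  by rewrite e1 e2 e3 v3E; ring.
have h' : (r1 - r2) * v2 - (r2 - r3) * v1 = 0.
  rewrite (_ : _ - _ = r1 * v2 + r2 * v3 + r3 * v1); last by rewrite v3E; ring.
  by rewrite e1' e2' e3' v3E; ring.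
have r23 : r2 - r3 = 0.
  apply: (mulIf N0); rewrite mul0r.
  (* Cramer's rule: this combination eliminates r1 and leaves r2 - r3 times the quadratic form. *)
  transitivity (v2 * ((r1 - r3) * v1 + (r2 - r3) * v2)
    - v1 * ((r1 - r2) * v2 - (r2 - r3) * v1)); first by ring.
  by rewrite h h' !mulr0 subr0.
have r13 : r1 - r3 = 0.
  apply: (mulIf N0); rewrite mul0r.
  transitivity ((v1 + v2) * ((r1 - r3) * v1 + (r2 - r3) * v2)
    + v2 * ((r1 - r2) * v2 - (r2 - r3) * v1)); first by ring.
  by rewrite h h' !mulr0 addr0.
by split; apply/eqP; rewrite -subr_eq0 ?r13 ?r23.
Qed.

(** * Traces of the blocks *)

Section Traces.
Variable R : realType.

Lemma sum_keval n (f : nat -> kterms) :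
  \sum_(i < n) keval R (f i) = keval R (flatten [seq f i | i <- iota 0 n]).
Proof. by rewrite keval_flatten -[n in iota 0 n]subn0 big_mkord. Qed.

(** The diagonal entries at 0 and 0' cancel; the others are a permutation of those of M, because the
    conjugating signs square to 1. *)
Lemma trace_S14 : \tr (S14 R) = \sum_x Mmx R x x.
Proof.
rewrite /mxtrace; under eq_bigr do rewrite mxE S14_entryE.
under [RHS]eq_bigr do rewrite MmxE; rewrite -!mulr_suml; congr (_ / _).
rewrite (sum_keval 14 (fun i => S14_terms (nth Lzero labels13 i)
  (nth Lzero labels13 i))) (sum_keval 12 (fun i => M_terms i i)).
by apply: keval_eq; vm_compute.
Qed.

Lemma trace_S5 : \tr (S5 R) = - (1 / 5) + \sum_j Wmx R j j.
Proof.
rewrite /mxtrace big_ord_recl S5_00; congr (_ + _).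
by apply: eq_bigr => j _; rewrite S5_W.
Qed.

Lemma trace_U : \sum_i Umx R i i = 2 / 5.
Proof.
under eq_bigr do rewrite UmxE; rewrite -mulr_suml.
rewrite (sum_keval 3 (fun i => nth [::] u_terms ((i + i) %% 3))).
(* The value of 26 [kappa 0] is 52, and 52 / 130 = 2 / 5. *)
rewrite (@keval_eq _ _ [:: (26, 0%N)]); last by vm_compute.
by rewrite keval_cons keval_nil kappa0; field.
Qed.

Lemma trace_Sprime : \tr (Sprime R) =
  (\sum_x Mmx R x x + (- (1 / 5) + \sum_j Wmx R j j + 3))%:C.
Proof.
rewrite /Sprime /direct_sum_mx -trace_S14 -trace_S5 -(mxtrace1 _ 3).
rewrite -(@mxtrace_block _ 5 3 _ 0 0) -(@mxtrace_block _ 14 8 _ 0 0).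
by rewrite /mxtrace rmorph_sum; apply: eq_bigr => i _; rewrite mxE.
Qed.

End Traces.

(** * Sums and case analysis over three indices *)

Section SmallSums.
Variable R : realType.

Lemma sum_ord3 (f : 'I_3 -> R[i]) :
  \sum_i f i = f ord0 + f (inord 1) + f (inord 2).
Proof.
rewrite !big_ord_recl big_ord0 addr0 addrA.
by congr (_ + f _ + f _); apply: val_inj; rewrite /= inordK.
Qed.

Lemma ord3_ind (P : 'I_3 -> Prop) :
  P ord0 -> P (inord 1) -> P (inord 2) -> forall i, P i.
Proof.
move=> h0 h1 h2; case=> [[|[|[|i]]] hi] //.
- by rewrite (_ : Ordinal hi = ord0) //; apply: val_inj.
- by rewrite (_ : Ordinal hi = inord 1) //; apply: val_inj; rewrite /= inordK.
- by rewrite (_ : Ordinal hi = inord 2) //; apply: val_inj; rewrite /= inordK.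
Qed.

Lemma expo_omega i : expo (omega i) = 0%N.
Proof. by case: i => [[|[|[|i]]] hi]. Qed.

Lemma expo_alpha i : expo (alpha i) = 0%N.
Proof. by case: i => [[|[|[|i]]] hi]. Qed.

Lemma fifthC : (1 / 5 : R)%:C = 1 / 5.
Proof. by rewrite fmorph_div rmorph1 rmorph_nat. Qed.

End SmallSums.

(** * Determination of S block by block *)

Section Determination.
Variables (R : realType) (S Q : 'M[R[i]]_22).
Hypothesis S_omega : forall i x, S (omega i) x = (Sfinal R (omega i) x)%:C.
Hypothesis S_sym : forall x y, S x y = S y x.
Hypothesis S_eig1 : S *m eigvec1 R = eigvec1 R.
Hypothesis S_eig2 : S *m eigvec2 R = eigvec2 R.
Hypothesis S_norm : forall x, \sum_y S (rest x) y * S (rest x) y = 1.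
Hypothesis Q_unit : Q \in unitmx.
Hypothesis QS : Q *m S = Sprime R *m Q.
Hypothesis QT : Q *m Tmx R = Tprime R *m Q.

Let Q_supp := intertwiner_support QT.
Let q x : R[i] := Q (block14 (match13 x)) (rest x).
Let q5 j : R[i] := Q (block5 (match5 j)) (beta j).

Let q_neq0 x : q x != 0.
Proof. exact: (intertwiner_neq0 Q_unit Q_supp (@expo_rest x)). Qed.

Let q5_neq0 j : q5 j != 0.
Proof. exact: (intertwiner_neq0 Q_unit Q_supp (@expo_beta j)). Qed.

Lemma Q_rest_rest x y :
  q x * S (rest x) (rest y) =
  (sign13 x * sign13 y)%:~R * (Mmx R x y)%:C * q y.
Proof.
rewrite (intertwine QS Q_supp (@expo_rest x) (@expo'_rest y)).
by rewrite Sprime_14 S14_M rmorphM rmorph_int.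
Qed.

(** The matched labels lie in different diagonal blocks of S'. *)
Lemma S_beta_rest j x : S (beta j) (rest x) = 0.
Proof.
apply: (mulfI (q5_neq0 j)).
rewrite (intertwine QS Q_supp (@expo_beta j) (@expo'_rest x)).
by rewrite Sprime_5_l mul0r mulr0.
Qed.

Lemma Q_beta_beta i j : q5 i * S (beta i) (beta j) = (Wmx R i j)%:C * q5 j.
Proof.
rewrite (intertwine QS Q_supp (@expo_beta i) (@expo'_beta j)).
by rewrite Sprime_5 S5_W.
Qed.

(** In S'Q only the labels of eigenvalue 1 contribute to column y, and among them only 0 and 0' lie
    in the level 13 block. *)
Lemma Q_rest x y : expo y = 0%N ->
  q x * S (rest x) y = - (sign13 x)%:~R *
  ((Vmx R ord0 x)%:C * Q (block14 ord0) y
   + (Vmx R (inord 1) x)%:C * Q (block14 ord_max) y).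
Proof.
move=> y0; rewrite (intertwine_row QS Q_supp y (@expo_rest x)).
rewrite (bigD1 (block14 ord0)) // (bigD1 (block14 ord_max)) //=.
rewrite !Sprime_14 S14_col0 S14_col13 !rmorphM !rmorphN !rmorph_int.
rewrite big1 ?addr0; first by ring.
move=> k /andP[k0 k13]; have [e|ne] := eqVneq (expo' k) 0%N; last first.
  by rewrite Q_supp ?mulr0 // y0.
case: (@split_ordP 14 8 k) e k0 k13 => [l ->|k' -> *]; last first.
  by rewrite Sprime_14_r mul0r.
by case/expo'_eq0_14 => -> ; rewrite /block14 eqxx.
Qed.

Lemma Q_beta j y : expo y = 0%N ->
  q5 j * S (beta j) y = - (1 / 5) * Q (block5 ord0) y.
Proof.
move=> y0; rewrite (intertwine_row QS Q_supp y (@expo_beta j)).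
rewrite (bigD1 (block5 ord0)) //= Sprime_5 S5_col0.
rewrite rmorphN fmorph_div rmorph1 rmorph_nat big1 ?addr0 // => k k0.
have [e|ne] := eqVneq (expo' k) 0%N; last by rewrite Q_supp ?mulr0 // y0.
case: (@split_ordP 14 8 k) e k0 => [l -> *|k' ->].
  by rewrite Sprime_5_l mul0r.
case: (@split_ordP 5 3 k') => [m ->|m -> *]; last by rewrite Sprime_5_r mul0r.
by move=> /expo'_eq0_5 ->; rewrite /block5 eqxx.
Qed.

Lemma S_rest_omega x k : S (rest x) (omega k) = (Vmx R k x)%:C.
Proof. by rewrite S_sym S_omega Sfinal_omega_rest. Qed.

Lemma S_beta_omega j k : S (beta j) (omega k) = 1 / 5.
Proof.
by rewrite S_sym S_omega Sfinal_omega_beta fmorph_div rmorph1 rmorph_nat.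
Qed.

Let r (x : 'I_12) : R[i] := (sign13 x)%:~R * q x.

Lemma r_V x k : r x * (Vmx R k x)%:C =
  (Vmx R ord0 x)%:C * - Q (block14 ord0) (omega k)
  + (Vmx R (inord 1) x)%:C * - Q (block14 ord_max) (omega k).
Proof.
rewrite -S_rest_omega /r -mulrA Q_rest ?expo_omega // mulrA mulrN -intrM.
by rewrite sign13_sq; ring.
Qed.

Let v k : R[i] := (keval R (nth [::] (v_terms ++ v_terms) k) / 26)%:C.

(** Multiplying by the block sign e removes it from V. With b = [x %/ 4], the cases k = 0, 1 make
    (v_b, v_(b+1)) a row eigenvector, of eigenvalue [r x], of a matrix independent of x. *)
Lemma r_v (x : 'I_12) (k : 'I_3) : r x * v (k + x %/ 4)%N =
  v (0 + x %/ 4)%N * - Q (block14 ord0) (omega k)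
  + v (1 + x %/ 4)%N * - Q (block14 ord_max) (omega k).
Proof.
pose e : int := nth 0 [:: 1; -1; -1] (x %/ 4).
have e_sq : e%:~R * e%:~R = 1 :> R[i].
  rewrite -intrM [e * e](_ : _ = 1) //; apply/eqP.
  apply: (@iota_allP 12 (fun x => nth 0 [:: 1; -1; -1] (x %/ 4)
    * nth 0 [:: 1; -1; -1] (x %/ 4) == 1 :> int)).
  by vm_compute.
have V_v (j : 'I_3) : (Vmx R j x)%:C = e%:~R * v (j + x %/ 4)%N.
  by rewrite VmxE keval_scale -mulrA rmorphM rmorph_int.
have := congr1 ( *%R e%:~R) (r_V x k); rewrite !V_v inordK //= => h.
rewrite -[LHS]mul1r -[RHS]mul1r -e_sq -[LHS]mulrA -[RHS]mulrA.
by rewrite [e%:~R * (r x * _)]mulrCA h; ring.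
Qed.

Lemma r_const x y : r x = r y.
Proof.
have v_sum : v 0%N + v 1%N + v 2%N = 0.
  have vE (k : 'I_3) : v k = (Vmx R k ord0)%:C.
    rewrite VmxE /V_terms (_ : (ord0 : 'I_12) %/ 4 = 0)%N // addn0.
    by rewrite keval_scale mul1r.
  transitivity (\sum_(k < 3) (Vmx R k ord0)%:C); last first.
    by rewrite -rmorph_sum sum_V rmorph0.
  by rewrite !big_ord_recr big_ord0 /= add0r -!vE.
have N0 : v 0%N ^+ 2 + v 0%N * v 1%N + v 1%N ^+ 2 != 0.
  rewrite /v -!rmorphXn -rmorphM -!rmorphD (Vmx_minor R).
  by rewrite fmorph_eq0 invr_eq0 pnatr_eq0.
have lo (i : 'I_4) : (i %/ 4 = 0)%N by rewrite divn_small.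
have mid (i : nat) : ((4 + i) %/ 4 = (i %/ 4).+1)%N by rewrite divnDl.
(* One label from each of gamma, delta, epsilon gives (v_0, v_1), (v_1, v_2), (v_2, v_3); the
   doubled list makes v_3 equal to v_0. *)
have cl (i j k : 'I_4) : r (@lshift 4 8 i) = r (@rshift 4 8 (@rshift 4 4 k)) /\
    r (@rshift 4 8 (@lshift 4 4 j)) = r (@rshift 4 8 (@rshift 4 4 k)).
  have E x' := (r_v x' ord0, r_v x' (inord 1)).
  have := E (@lshift 4 8 i); have := E (@rshift 4 8 (@lshift 4 4 j)).
  have := E (@rshift 4 8 (@rshift 4 4 k)).
  rewrite !inordK // => -[e3 e3'] [e2 e2'] [e1 e1'].
  move: e1 e1' e2 e2' e3 e3'; rewrite /= !mid !lo.
  exact: common_eigenvalue.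
have c0 z : r z = r ord0.
  have E0 : ord0 = @lshift 4 8 ord0 by apply: val_inj.
  move: z; apply: ord12_split => i; rewrite E0.
  - by rewrite (cl i i i).1 (cl ord0 i i).1.
  - by rewrite (cl i i i).2 (cl ord0 i i).1.
  - by rewrite (cl ord0 i i).1.
by rewrite !c0.
Qed.

Lemma S_rest_rest x y : S (rest x) (rest y) = (Mmx R x y)%:C.
Proof.
apply: (mulfI (q_neq0 x)); rewrite Q_rest_rest.
have s2 (z : 'I_12) : (sign13 z)%:~R * (sign13 z)%:~R = 1 :> R[i].
  by rewrite -intrM sign13_sq.
have qE (z : 'I_12) : q z = (sign13 z)%:~R * r z by rewrite /r mulrA s2 mul1r.
rewrite !qE (r_const y x) intrM.
transitivity ((sign13 y)%:~R * (sign13 y)%:~R * ((sign13 x)%:~R * r x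
  * (Mmx R x y)%:C)); first by ring.
by rewrite s2 mul1r.
Qed.

(** All entries S_{beta_k omega_0} equal 1/5, so [Q_beta] in that column yields one value for every
    k. *)
Lemma q5_const i j : q5 i = q5 j.
Proof.
have h k : q5 k = - Q (block5 ord0) (omega ord0).
  apply: (mulIf (_ : 1 / 5 != 0 :> R[i])).
    by rewrite div1r invr_eq0 pnatr_eq0.
  by rewrite -(S_beta_omega k ord0) Q_beta ?expo_omega // S_beta_omega; ring.
by rewrite !h.
Qed.

Lemma S_beta_beta i j : S (beta i) (beta j) = (Wmx R i j)%:C.
Proof.
by apply: (mulfI (q5_neq0 i)); rewrite Q_beta_beta (q5_const j i) mulrC.
Qed.

Lemma eig_row1 x : \sum_i S x (omega i) + \sum_i S x (alpha i) = eigvec1 R x 0.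
Proof.
rewrite -[in RHS]S_eig1 mxE sum_blocks [X in _ = _ + X]big1; last first.
  by move=> k _; rewrite mxE nth_default ?mulr0.
rewrite [X in _ = _ + X + 0]big1 ?addr0.
  by congr (_ + _); apply: eq_bigr; case=> [[|[|[|i]]] hi] // _;
    rewrite mxE mulr1.
by move=> k _; rewrite mxE nth_default ?mulr0.
Qed.

(** The list behind [eigvec2] has five entries, so the coefficient of alpha_3 is the default value
    0. *)
Lemma eig_row2 x : \sum_i S x (omega i) + (2 * S x (alpha ord0)
  + S x (alpha (inord 1))) = eigvec2 R x 0.
Proof.
rewrite -[in RHS]S_eig2 mxE sum_blocks [X in _ = _ + X]big1; last first.
  by move=> k _; rewrite mxE nth_default ?mulr0.
rewrite [X in _ = _ + X + 0]big1 ?addr0; last first.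
  by move=> k _; rewrite mxE nth_default ?mulr0.
congr (_ + _).
  by apply: eq_bigr; case=> [[|[|[|i]]] hi] // _; rewrite mxE mulr1.
rewrite !big_ord_recl big_ord0 !mxE /= addr0 mulr0 addr0 mulr1 mulrC.
by congr (_ + S _ (alpha _)); apply: val_inj; rewrite /= inordK.
Qed.

(** The eigenvector equations force the shape (a, -2a, a), which adds 6 a ^ 2 to a norm that is
    already 1 by [norm_VM]. *)
Lemma S_rest_alpha x i : S (rest x) (alpha i) = 0.
Proof.
have om : \sum_k S (rest x) (omega k) = 0.
  under eq_bigr do rewrite S_rest_omega.
  by rewrite -rmorph_sum sum_V rmorph0.
have := eig_row1 (rest x); have := eig_row2 (rest x).
rewrite om !add0r sum_ord3 !mxE !nth_default //.
set a := S _ _; set a1 := S _ _; set a2 := S _ _ => h2 h1.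
have a1E : a1 = - 2 * a by apply/eqP; rewrite -subr_eq0 -h2; apply/eqP; ring.
have a2E : a2 = a by apply/eqP; rewrite -subr_eq0 -h1 a1E; apply/eqP; ring.
have a0 : a = 0.
  have := S_norm x; rewrite sum_blocks.
  rewrite (sum_ord3 (fun i => S (rest x) (alpha i) * S (rest x) (alpha i))).
  rewrite -/a -/a1 -/a2.
  rewrite [X in _ + X + _]big1; last first.
    by move=> j _; rewrite S_sym S_beta_rest mul0r.
  have -> : \sum_i S (rest x) (omega i) * S (rest x) (omega i)
      = (\sum_k Vmx R k x ^+ 2)%:C.
    by rewrite rmorph_sum; apply: eq_bigr => k _; rewrite S_rest_omega rmorphXn.
  have -> : \sum_y S (rest x) (rest y) * S (rest x) (rest y)
      = (\sum_y Mmx R x y ^+ 2)%:C.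
    by rewrite rmorph_sum; apply: eq_bigr => y _; rewrite S_rest_rest rmorphXn.
  have := congr1 (real_complex R) (norm_VM R x); rewrite rmorphD rmorph1 => <-.
  move=> h; have : 6 * a ^+ 2 = 0.
    by move/eqP: h; rewrite -subr_eq0 a1E a2E => /eqP <-; ring.
  by move=> /eqP; rewrite mulf_eq0 pnatr_eq0 expf_eq0 /= => /eqP.
by move: i; apply: ord3_ind; rewrite -/a -/a1 -/a2 ?a1E ?a2E a0 ?mulr0.
Qed.

(** The eigenvector equations force the shape (s, -3/5 - 2s, s); the sum of squares 3/25 then fixes
    s. *)
Lemma S_beta_alpha j i : S (beta j) (alpha i) = - (1 / 5).
Proof.
have Q0 y : expo y = 0%N -> Q (block5 ord0) y = - 5 * q5 j * S (beta j) y.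
  by move=> y0; rewrite -mulrA Q_beta //; field.
have om : \sum_k S (beta j) (omega k) = 3 / 5.
  by rewrite sum_ord3 !S_beta_omega; field.
have := eig_row1 (beta j); have := eig_row2 (beta j).
rewrite om sum_ord3 !mxE !nth_default //.
set s := S _ _; set s1 := S _ _; set s2 := S _ _ => h2 h1.
have s1E : s1 = - (3 / 5) - 2 * s.
  by apply/eqP; rewrite -subr_eq0 -h2; apply/eqP; field.
have s2E : s2 = s by apply/eqP; rewrite -subr_eq0 -h1 s1E; apply/eqP; field.
have sq : s ^+ 2 + s1 ^+ 2 + s2 ^+ 2 = 3 / 25.
  (* The entry (0, beta_j) of QS = S'Q, with 0 the first row of the level 5
     block, gives this norm. *)
  have bb : \sum_k Q (block5 ord0) (beta k) * S (beta k) (beta j) = 0.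
    apply: big1 => k _.
    by rewrite Q_supp ?mul0r //; case: k => [[|[|[|[|k]]]] hk].
  have rb : \sum_x Q (block5 ord0) (rest x) * S (rest x) (beta j) = 0.
    by apply: big1 => x _; rewrite S_sym S_beta_rest mulr0.
  have := intertwine_col QS Q_supp (block5 ord0) (@expo'_beta j).
  rewrite Sprime_5 S5_row0 sum_blocks bb rb !sum_ord3.
  rewrite !Q0 ?expo_omega ?expo_alpha // -/(q5 j).
  rewrite ![S _ (beta j)]S_sym !S_beta_omega -/s -/s1 -/s2.
  rewrite rmorphN fmorph_div !rmorph_nat => h.
  apply: (mulfI (q5_neq0 j)); apply: (mulfI (_ : 5 != 0 :> R[i])).
    by rewrite pnatr_eq0.
  move/eqP: h; rewrite -subr_eq0 => /eqP h.
  by apply/eqP; rewrite -subr_eq0 -oppr_eq0 -h; apply/eqP; field.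
have sE : s = - (1 / 5).
  (* The quadratic equation for s has a double root, so it leaves no choice of sign. *)
  have : (s + 1 / 5) ^+ 2 = 0.
    move: sq; rewrite s2E s1E => /eqP; rewrite -subr_eq0 => /eqP h.
    transitivity ((s ^+ 2 + (- (3 / 5) - 2 * s) ^+ 2 + s ^+ 2 - 3 / 25) / 6).
      by field.
    by rewrite h mul0r.
  by move=> /eqP; rewrite expf_eq0 /= addr_eq0 => /eqP.
by move: i; apply: ord3_ind; rewrite -/s -/s1 -/s2 ?s1E ?s2E ?sE //; field.
Qed.

(** By symmetry and the eigenvector equations all entries are affine in the corner entry a; the
    trace becomes 6 a - 12/5, so its value 12/5 gives a = 4/5. *)
Lemma S_alpha_alpha i j : S (alpha i) (alpha j) = (i == j)%:R - 1 / 5.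
Proof.
have om k : \sum_l S (alpha k) (omega l) = 3 / 5.
  under eq_bigr do rewrite S_sym S_omega Sfinal_omega_alpha fifthC.
  by rewrite sum_ord3; field.
have e1 k := eig_row1 (alpha k); have e2 k := eig_row2 (alpha k).
have v1 k : eigvec1 R (alpha k) 0 = 1.
  by rewrite mxE; case: k => [[|[|[|k]]] hk].
(* The traces of M and W occur on both sides of tr S = tr S'; what remains is 3 - 1/5 from S' minus
   2/5 from U. *)
have tr : \sum_k S (alpha k) (alpha k) = 12 / 5.
  have := intertwiner_trace Q_unit QS; rewrite trace_Sprime /mxtrace sum_blocks.
  under [X in X + _ + _ + _]eq_bigr do rewrite S_omega Sfinal_omega_omega.
  under [X in _ + _ + X + _]eq_bigr do rewrite S_beta_beta.
  under [X in _ + _ + _ + X]eq_bigr do rewrite S_rest_rest.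
  rewrite -!rmorph_sum trace_U 3!rmorphD rmorphN !fmorph_div rmorph1.
  rewrite !rmorph_nat.
  move: (\sum_k S (alpha k) (alpha k)) (real_complex R (\sum_x Mmx R x x))
    (real_complex R (\sum_j Wmx R j j)) => E M W /eqP.
  rewrite -subr_eq0 => /eqP h.
  by apply/eqP; rewrite -subr_eq0 -h; apply/eqP; field.
move: (e1 ord0) (e1 (inord 1)) (e1 (inord 2)) (e2 ord0) (e2 (inord 1)) tr.
rewrite !om !v1 !sum_ord3 !mxE /= !inordK //=.
rewrite ![S (alpha (inord _)) (alpha ord0)]S_sym.
rewrite ![S (alpha (inord 2)) (alpha (inord 1))]S_sym.
set a := S _ (alpha ord0); set b := S (alpha ord0) (alpha (inord 1)).
set c := S (alpha ord0) (alpha (inord 2)).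
set d := S (alpha (inord 1)) (alpha (inord 1)).
set e := S (alpha (inord 1)) (alpha (inord 2)).
set f := S (alpha (inord 2)) (alpha (inord 2)).
move=> h0 h1 h2 k0 k1 t.
have bE : b = 7 / 5 - 2 * a.
  apply/eqP; rewrite -subr_eq0 -(subrr 2) -[X in _ == X - _]k0.
  by apply/eqP; field.
have cE : c = a - 1.
  apply/eqP; rewrite -subr_eq0 -(subrr 1) -[X in _ == X - _]h0 bE.
  by apply/eqP; field.
have dE : d = 4 * a - 12 / 5.
  apply/eqP; rewrite -subr_eq0 -(subrr 1) -[X in _ == X - _]k1 bE.
  by apply/eqP; field.
have eE : e = b.
  apply/eqP; rewrite -subr_eq0 -(subrr 1) -[X in _ == X - _]h1 dE bE.
  by apply/eqP; field.
have fE : f = a.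
  apply/eqP; rewrite -subr_eq0 -(subrr 1) -[X in _ == X - _]h2 eE bE cE.
  by apply/eqP; field.
have aE : a = 4 / 5.
  have : 6 * a = 24 / 5.
    transitivity (a + d + f + 12 / 5); first by rewrite dE fE; field.
    by rewrite t; field.
  move=> h; apply: (mulfI (_ : 6 != 0 :> R[i])); rewrite ?pnatr_eq0 // h.
  by field.
move: i j; do 2!apply: ord3_ind; rewrite -?val_eqE /= ?inordK //=;
  rewrite ?[S (alpha (inord _)) (alpha ord0)]S_sym
    ?[S (alpha (inord 2)) (alpha (inord 1))]S_sym -/a -/b -/c -/d -/e -/f;
  by rewrite ?fE ?eE ?dE ?cE ?bE aE; field.
Qed.

Lemma S_determined : S = map_mx (real_complex R) (Sfinal R).
Proof.
apply/matrixP => x y; rewrite mxE.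
move: x y; apply: ord22_split => i; apply: ord22_split => j //.
- by rewrite S_sym S_omega Sfinal_sym.
- rewrite S_alpha_alpha Sfinal_alpha_alpha rmorphB fmorph_div rmorph1.
  by rewrite !rmorph_nat.
- rewrite S_sym S_beta_alpha Sfinal_alpha_beta rmorphN fmorph_div rmorph1.
  by rewrite rmorph_nat.
- by rewrite S_sym S_rest_alpha Sfinal_alpha_rest rmorph0.
- by rewrite S_sym S_omega Sfinal_sym.
- rewrite S_beta_alpha Sfinal_sym Sfinal_alpha_beta rmorphN fmorph_div rmorph1.
  by rewrite rmorph_nat.
- by rewrite S_beta_beta Sfinal_beta_beta.
- by rewrite S_beta_rest Sfinal_beta_rest rmorph0.
- by rewrite S_rest_omega Sfinal_sym Sfinal_omega_rest.
- by rewrite S_rest_alpha Sfinal_sym Sfinal_alpha_rest rmorph0.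
- by rewrite S_sym S_beta_rest Sfinal_sym Sfinal_beta_rest rmorph0.
- by rewrite S_rest_rest Sfinal_rest_rest.
Qed.

End Determination.

Theorem theorem9p1 (R : realType) (sigma : R[i] -> R[i]) (S Q : 'M[R[i]]_22)
    (hsigma : is_sigma sigma)
    (hrows : forall (i : 'I_3) (x : 'I_22),
       S (omega i) x = iter i sigma (S_row0 R)`_x /\
       S x (omega i) = iter i sigma (S_row0 R)`_x)
    (heig1S : col_eigenvector S 1 (eigvec1 R))
    (heig1T : col_eigenvector (Tmx R) 1 (eigvec1 R))
    (heig2S : col_eigenvector S 1 (eigvec2 R))
    (heig2T : col_eigenvector (Tmx R) 1 (eigvec2 R))
    (hsym : S^T = S)
    (hnorm : forall (j : 'I_4) (x : 'I_22),
       x \in [:: gamma j; delta j; epsilon j] ->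
       \sum_(y < 22) S x y * S x y = 1)
    (hQ : Q \in unitmx)
    (hQS : Q *m S = Sprime R *m Q)
    (hQT : Q *m Tmx R = Tprime R *m Q) :
  S = map_mx (real_complex R) (Sfinal R).
Proof.
apply: (@S_determined R S Q) => //.
- by move=> i x; rewrite (hrows i x).1 first_rows.
- by move=> x y; rewrite -[in LHS]hsym mxE.
- by case: heig1S => _; rewrite scale1r.
- by case: heig2S => _; rewrite scale1r.
apply: ord12_split => j; apply: (hnorm j); rewrite !inE.
- by apply/orP; left; apply/eqP/val_inj.
- by apply/orP; right; apply/orP; left; apply/eqP/val_inj.
- by apply/orP; right; apply/orP; right; apply/eqP/val_inj.
Qed.
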